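(* Consider a normal form game between players $I=\{1,\ldots,N\}$ with finite pure strategy sets $S_i=\{s_{i0},\ldots,s_{id_i}\}$ and utility functions $u_i\colon\prod_{j\in I}S_j\to\mathbb{R}$ that obeys a directed graphical model $\gamma$ (a directed graph without self-loops with nodes $1,\ldots,N$). Construct a directed graph $G$ with node set $\coprod_{i\in I}(S_i\setminus\{s_{i0}\})$ such that there is an edge from $s_{ik}$ to $s_{jl}$ in $G$ if and only if there is an edge from $i$ to $j$ in $\gamma$. Put $T_i=S_i\setminus\{s_{i0}\}$, associate to the node $s_{ik}$ the variable $\sigma_i(s_{ik})$, and associate to it the polynomial $$f_{ik}=u_i(s_{ik},\sigma_{-i})-u_i(s_{i0},\sigma_{-i}).$$ Then the system $\{f_{ik}=0\}$ defining the quasiequilibria of the game satisfies: (0) $G$ has no self-loops, and if $G$ has an edge from a node to some element of $T_j$, then it has edges from that node to every element of $T_j$; (1) all monomials occurring in the $f_{ik}$'s are squarefree; (2) two distinct variables associated to nodes of the same $T_j$ never occur in the same monomial of any $f_{ik}$; (3) if there is no edge from $s_{ik}$ to $s_{jl}$ in $G$, then $\sigma_j(s_{jl})$ does not occur in $f_{ik}$. Consequently, for generic utility functions obeying $\gamma$, the number of quasiequilibria with all coordinates $\sigma_i(s_{ik})$ ($1\le k\le d_i$) nonzero equals the permanent of the square matrix $M$, indexed by the nodes of $G$, with entry $\dfrac{1}{(d_j!)^{1/d_j}}$ in row $s_{ik}$ and column $s_{jl}$ if there is an edge from $s_{ik}$ to $s_{jl}$ in $G$, and $0$ otherwise.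
   Context: The game obeys the directed graphical model $\gamma$ if, for each player $i$, the payoff $u_i(s)$ depends only on $s_i$ and on the $s_j$ for those players $j\ne i$ such that $\gamma$ has an edge from $i$ to $j$. Here $u_i(s_{ik},\sigma_{-i})=\sum_{s_{-i}\in\prod_{j\neq i}S_j}u_i(s_{ik},s_{-i})\prod_{j\ne i}\sigma_j(s_j)$, in which $\sigma_j(s_{j0})$ is replaced by $1-\sum_{l=1}^{d_j}\sigma_j(s_{jl})$ for each $j$, and common contributions are collected so that $u_i(s_{ik},\sigma_{-i})$ is regarded as a polynomial in the variables $\sigma_j(s_{jl})$, $j\in I$, $1\le l\le d_j$. The quasiequilibria of the game are the complex solutions of the system $f_{ik}=0$, $i\in I$, $1\le k\le d_i$. ''Generic utility functions obeying $\gamma$'' means: outside a proper algebraic subset of the linear space of all tuples $(u_i)_{i\in I}$ of utility functions obeying $\gamma$. *)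

(* Defs.v *)
From mathcomp Require Import all_boot all_order all_algebra all_fingroup.
From mathcomp Require Import classical_sets cardinality reals exp complex.
From mathcomp Require Import mpoly.

Set Implicit Arguments.
Unset Strict Implicit.
Unset Printing Implicit Defensive.

Import GRing.Theory.
Local Open Scope ring_scope.

(* The players are 'I_N. The pure strategies s_{i0}, ..., s_{i d_i} of player   *)
(* i are the elements 0, ..., d_i of 'I_(d i).+1.                              *)

Definition strategy_profile (N : nat) (d : 'I_N -> nat) :=
  {dffun forall j : 'I_N, 'I_(d j).+1}.

Definition game (R : Type) (N : nat) (d : 'I_N -> nat) :=
  'I_N -> strategy_profile d -> R.

Definition obeys (R : Type) (N : nat) (d : 'I_N -> nat) (gamma : rel 'I_N)
    (u : game R d) : Prop :=
  forall (i : 'I_N) (s t : strategy_profile d),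
    s i = t i -> (forall j, j != i -> gamma i j -> s j = t j) ->
    u i s = u i t.

(* The disjoint union of the sets T_i: the pair of i and k : 'I_(d i)          *)
(* stands for s_{i,k+1} = lift ord0 k, so that s_{i0} is left out.             *)
Definition node (N : nat) (d : 'I_N -> nat) := {i : 'I_N & 'I_(d i)}.

Definition mknode (N : nat) (d : 'I_N -> nat) (i : 'I_N) (k : 'I_(d i)) :
  node d := Tagged (fun j => 'I_(d j)) k.

Definition node_graph (N : nat) (d : 'I_N -> nat) (gamma : rel 'I_N) :
  rel (node d) := fun x y => gamma (tag x) (tag y).

Section Polynomials.

Variables (R : nzRingType) (N : nat) (d : 'I_N -> nat).

(* The variables sigma_j(s_{jl}) are numbered by the rank of their node.       *)
Definition sigma_var (y : node d) : {mpoly R[#|{: node d}|]} :=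
  'X_(enum_rank y).

Definition var_exponent (m : 'X_{1..#|{: node d}|}) (y : node d) : nat :=
  m (enum_rank y).

Definition sigma (j : 'I_N) (a : 'I_(d j).+1) : {mpoly R[#|{: node d}|]} :=
  if unlift ord0 a is Some l then sigma_var (mknode l)
  else 1 - \sum_(l < d j) sigma_var (mknode l).

(* u_i(a, sigma_{-i}): the profiles s with s i = a stand for the s_{-i}.       *)
Definition payoff_poly (u : game R d) (i : 'I_N) (a : 'I_(d i).+1) :
    {mpoly R[#|{: node d}|]} :=
  \sum_(s : strategy_profile d | s i == a)
    (u i s)%:MP * \prod_(j < N | j != i) sigma (s j).

Definition quasi_poly (u : game R d) (x : node d) : {mpoly R[#|{: node d}|]} :=
  payoff_poly u (lift ord0 (tagged x)) - payoff_poly u (@ord0 (d (tag x))).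

End Polynomials.

Definition quasiequilibrium (R : realType) (N : nat) (d : 'I_N -> nat)
    (u : game R d) (z : {ffun node d -> R[i]}) : Prop :=
  forall x : node d,
    (map_mpoly (real_complex R) (quasi_poly u x)).@[fun a => z (enum_val a)]
    = 0.

Definition torus_quasiequilibria (R : realType) (N : nat) (d : 'I_N -> nat)
    (u : game R d) : set {ffun node d -> R[i]} :=
  [set z | quasiequilibrium u z /\ forall x, z x != 0]%classic.

(* The coordinates on the space of all utility tuples are the values u_i(s).   *)
(* Polynomial functions on the linear subspace of the tuples obeying gamma     *)
(* are the restrictions of polynomials in these coordinates.                   *)
Definition payoff_index (N : nat) (d : 'I_N -> nat) :=
  ('I_N * strategy_profile d)%type.

Definition eval_at_game (R : comNzRingType) (N : nat) (d : 'I_N -> nat)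
    (p : {mpoly R[#|{: payoff_index d}|]}) (u : game R d) : R :=
  p.@[fun c => u (enum_val c).1 (enum_val c).2].

Definition games_obeying (R : Type) (N : nat) (d : 'I_N -> nat)
    (gamma : rel 'I_N) : set (game R d) := [set u | obeys gamma u]%classic.

Definition algebraic_subset (R : comNzRingType) (N : nat) (d : 'I_N -> nat)
    (gamma : rel 'I_N) (Z : set (game R d)) : Prop :=
  exists ps : seq {mpoly R[#|{: payoff_index d}|]},
    Z = [set u | obeys gamma u /\
                 forall p, p \in ps -> eval_at_game p u = 0]%classic.

Definition for_generic_games (R : comNzRingType) (N : nat) (d : 'I_N -> nat)
    (gamma : rel 'I_N) (P : game R d -> Prop) : Prop :=
  exists Z : set (game R d),
    [/\ algebraic_subset gamma Z,
        (Z `<` games_obeying gamma)%classic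
      & forall u, obeys gamma u -> ~ Z u -> P u].

Definition permanent (R : comNzRingType) (n : nat) (A : 'M[R]_n) : R :=
  \sum_(s : 'S_n) \prod_(a < n) A a (s a).

(* If d_j = 0 then no column belongs to player j, so the exponent 1 / d_j      *)
(* below is always that of a positive d_j.                                     *)
Definition graph_matrix (R : realType) (N : nat) (d : 'I_N -> nat)
    (gamma : rel 'I_N) : 'M[R]_#|{: node d}| :=
  \matrix_(a, b)
    let x : node d := enum_val a in
    let y : node d := enum_val b in
    let dj := d (tag y) in
    if node_graph gamma x y then ((dj`!)%:R `^ (dj%:R^-1))^-1 else 0.

(* Main.v *)
Require Import Defs.
From mathcomp Require Import all_boot all_order all_algebra all_fingroup.
From mathcomp Require Import classical_sets cardinality reals exp complex.
From mathcomp Require Import finmap separable mpoly zify ring.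

(* The polynomial f_x of a node x = s_{ik} is an arbitrary multi-affine function
   of the blocks sigma_j with gamma i j, so it can be specialised to a product
   over these j of the values p_j(t_x), where p_j(T) = 1 + \sum_l sigma_j(s_{jl})
   T^l and the t_x > 0 are distinct. The solutions of the special system are then
   explicit: each p_j has degree at most d_j and there are \sum_j d_j nodes, so
   they correspond to the assignments c of a neighbouring player c(x) to each x
   with d_j nodes assigned to each j. Let D be their number; grouping the terms of
   the permanent by x |-> player of s(x) shows that it equals D.

   Splitting the products factor by factor shows that, in bounded multidegree,
   the quotient by the special system is spanned by D elements, hence by the
   powers 1, ..., L^(D-1) of a linear form L separating the D solutions.
   Cramer's rule extends this to nearby games u: up to a factor elim_lead u, the
   variables of any solution are polynomials in L, and L is a root of a polynomial
   Q_u of degree D, all polynomial in u. Conversely every root of Q_u gives a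
   solution when elim_lead u is nonzero: on the line from the special game to u
   the D nondegenerate solutions lift to every order by Newton's method, so the
   required identities modulo Q_u hold along the line. The number of torus
   solutions is therefore D when moreover a resultant, nonzero at the special
   game, does not vanish.                                                      *)

Set Implicit Arguments.
Unset Strict Implicit.
Unset Printing Implicit Defensive.

Import Order.TTheory GRing.Theory Num.Theory.
Local Open Scope ring_scope.

(** * Block degrees *)

Section BlockDegree.

Variables (N : nat) (d : 'I_N -> nat).
Implicit Types (e : 'X_{1..#|{: node d}|}) (b : 'I_N -> nat).

Definition block_degree e (j : 'I_N) : nat :=
  (\sum_(l < d j) var_exponent e (mknode l))%N.

Lemma block_degree0 j : block_degree 0%MM j = 0%N.
Proof. by rewrite /block_degree big1 // => l _; rewrite /var_exponent mnm0E. Qed.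

Lemma block_degreeD e1 e2 j :
  block_degree (e1 + e2)%MM j = (block_degree e1 j + block_degree e2 j)%N.
Proof.
by rewrite /block_degree -big_split; apply: eq_bigr => l _; rewrite /var_exponent mnmDE.
Qed.

Lemma mknodeE (x : node d) : mknode (tagged x) = x.
Proof. by case: x. Qed.

Lemma block_degree_var (x : node d) j :
  block_degree U_(enum_rank x)%MM j = (tag x == j).
Proof.
rewrite /block_degree /var_exponent; case: x => i k /=; case: eqVneq => [<-|neq].
  rewrite (bigD1 k) //= mnm1E eqxx big1 // => l /negPf neq.
  by rewrite mnm1E (inj_eq enum_rank_inj) /mknode eq_Tagged /= eq_sym neq.
rewrite big1 // => l _; rewrite mnm1E (inj_eq enum_rank_inj).
by case: eqP => // /(congr1 tag) /= eq_ij; rewrite eq_ij eqxx in neq.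
Qed.

Lemma var_exponent_le e (x : node d) : (var_exponent e x <= block_degree e (tag x))%N.
Proof.
by rewrite -{1}(mknodeE x) /block_degree (bigD1 (tagged x)) //= leq_addr.
Qed.

Lemma var_exponent2_le e (x y : node d) : tag x = tag y -> x != y ->
  (var_exponent e x + var_exponent e y <= block_degree e (tag x))%N.
Proof.
case: x y => [i k] [j l] /= eq_ij; case: j / eq_ij l => l.
rewrite eq_Tagged /= => neq.
by rewrite /block_degree (bigD1 k) //= (bigD1 l) 1?eq_sym //= addnA leq_addr.
Qed.

Section Bounded.

Variable R : nzRingType.
Implicit Types p q : {mpoly R[#|{: node d}|]}.

Definition block_bounded b p : Prop :=
  forall e, e \in msupp p -> forall j, (block_degree e j <= b j)%N.

Lemma block_boundedW b b' p : (forall j, (b j <= b' j)%N) ->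
  block_bounded b p -> block_bounded b' p.
Proof. by move=> le_bb' bp e /bp bpe j; exact: leq_trans (bpe j) (le_bb' j). Qed.

Lemma block_bounded0 b : block_bounded b 0.
Proof. by move=> e; rewrite -mpolyC0 msuppC eqxx. Qed.

Lemma block_boundedC b c : block_bounded b c%:MP.
Proof.
move=> e; rewrite msuppC; case: ifP => // _; rewrite inE => /eqP-> j.
by rewrite block_degree0.
Qed.

Lemma block_bounded1 b : block_bounded b 1.
Proof. exact: block_boundedC. Qed.

Lemma block_boundedX b e :
  (forall j, (block_degree e j <= b j)%N) -> block_bounded b 'X_[e].
Proof. by move=> be e'; rewrite msuppX inE => /eqP->. Qed.

Lemma block_bounded_var b (x : node d) :
  (0 < b (tag x))%N -> block_bounded b (sigma_var R x).
Proof.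
move=> bx; apply: block_boundedX => j; rewrite block_degree_var.
by case: eqVneq => // <-.
Qed.

Lemma block_boundedN b p : block_bounded b p -> block_bounded b (- p).
Proof. by move=> bp e; rewrite (perm_mem (msuppN _)) => /bp. Qed.

Lemma block_boundedD b p q :
  block_bounded b p -> block_bounded b q -> block_bounded b (p + q).
Proof.
by move=> bp bq e /msuppD_le; rewrite mem_cat => /orP[/bp|/bq].
Qed.

Lemma block_boundedB b p q :
  block_bounded b p -> block_bounded b q -> block_bounded b (p - q).
Proof. by move=> bp bq; apply/block_boundedD/block_boundedN. Qed.

Lemma block_bounded_sum b (I : Type) (r : seq I) (P : pred I) F :
  (forall i, P i -> block_bounded b (F i)) ->
  block_bounded b (\sum_(i <- r | P i) F i).
Proof.
move=> bF; elim/big_rec: _ => [|i p Pi bp]; first exact: block_bounded0.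
by apply: block_boundedD => //; apply: bF.
Qed.

Lemma block_boundedM b1 b2 p q : block_bounded b1 p -> block_bounded b2 q ->
  block_bounded (fun j => b1 j + b2 j)%N (p * q).
Proof.
move=> bp bq e /msuppM_le /allpairsP[[e1 e2] /= [/bp be1 /bq be2 ->]] j.
by rewrite block_degreeD leq_add.
Qed.

Lemma block_boundedZ b c p : block_bounded b p -> block_bounded b (c *: p).
Proof. by move=> bp e /msuppZ_le /bp. Qed.

Lemma block_bounded_exp b p k : block_bounded b p ->
  block_bounded (fun j => k * b j)%N (p ^+ k).
Proof.
move=> bp; elim: k => [|k IHk]; first by rewrite expr0; apply: block_bounded1.
by rewrite exprS; apply: block_boundedW (block_boundedM bp IHk) => j; rewrite mulSn.
Qed.

Lemma block_bounded_prod (I : Type) (r : seq I) (P : pred I) F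
    (B : I -> 'I_N -> nat) :
  (forall i, P i -> block_bounded (B i) (F i)) ->
  block_bounded (fun j => \sum_(i <- r | P i) B i j)%N (\prod_(i <- r | P i) F i).
Proof.
move=> bF; elim: r => [|i r IHr].
  by rewrite big_nil; apply: block_bounded1.
rewrite big_cons; case: ifP => Pi; last first.
  by apply: block_boundedW IHr => j; rewrite big_cons Pi.
apply: block_boundedW (block_boundedM (bF i Pi) IHr) => j.
by rewrite big_cons Pi.
Qed.

Lemma block_bounded_sigma (j : 'I_N) (a : 'I_(d j).+1) :
  block_bounded (fun i => (i == j : nat)) (sigma R a).
Proof.
rewrite /sigma; case: unliftP => [l _|_].
  by apply: block_bounded_var; rewrite /= eqxx.
apply: block_boundedB; first exact: block_bounded1.
by apply: block_bounded_sum => l _; apply: block_bounded_var; rewrite /= eqxx.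
Qed.

End Bounded.

End BlockDegree.

(** * Sums over strategy profiles *)

Section DependentProducts.

Variables (N : nat) (d : 'I_N -> nat).

Definition update_profile (s : strategy_profile d) (j : 'I_N) (a : 'I_(d j).+1) :
    strategy_profile d := [ffun i => dfwith s a i].

Lemma update_profile_in s j (a : 'I_(d j).+1) : update_profile s a j = a.
Proof. by rewrite ffunE dfwith_in. Qed.

Lemma update_profile_out s j (a : 'I_(d j).+1) i :
  i != j -> update_profile s a i = s i.
Proof. by move=> neq; rewrite ffunE dfwith_out // eq_sym. Qed.

(** Profiles that differ only at [j] are grouped together, and the one playing [ord0] there
    represents its group. The hypothesis makes [P] constant on each group. *)
Lemma big_update_profile (V : nmodType) (j : 'I_N) (P : pred (strategy_profile d))
    (F : strategy_profile d -> V) :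
  (forall s (a : 'I_(d j).+1), P (update_profile s a) = P s) ->
  \sum_(s | P s) F s =
  \sum_(s | P s && (s j == ord0)) \sum_(a < (d j).+1) F (update_profile s a).
Proof.
move=> Pj; pose h s := update_profile s (@ord0 (d j)).
rewrite (partition_big h (fun s => P s && (s j == ord0))) /=; last first.
  by move=> s Ps; rewrite Pj Ps update_profile_in eqxx.
apply: eq_bigr => s /andP[Ps /eqP sj0].
rewrite (reindex_onto (fun a : 'I_(d j).+1 => update_profile s a)
                      (fun t : strategy_profile d => t j)) /=; last first.
  move=> t /andP[Pt /eqP <-]; apply/ffunP => i.
  have [->|neq] := eqVneq i j; first by rewrite update_profile_in.
  by rewrite !update_profile_out.
apply: eq_bigl => a; rewrite Pj Ps update_profile_in eqxx andbT /=.
apply/eqP/ffunP => i; have [->|neq] := eqVneq i j.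
  by rewrite update_profile_in sj0.
by rewrite !update_profile_out.
Qed.

Lemma sum_prod_profile (R : comNzRingType) (i : 'I_N) (a : 'I_(d i).+1)
    (F : forall j, 'I_(d j).+1 -> R) :
  \sum_(s : strategy_profile d | s i == a) \prod_(j | j != i) F j (s j) =
  \prod_(j | j != i) \sum_(b < (d j).+1) F j b.
Proof.
pose r := [seq j <- index_enum 'I_N | j != i].
have ur : uniq r by rewrite filter_uniq ?index_enum_uniq.
(* Induction on the list of players whose strategies are summed over; every player outside the list,
   except [i], is pinned to [ord0]. *)
suff key (r' : seq 'I_N) : uniq r' -> i \notin r' ->
    \sum_(s : strategy_profile d | (s i == a) &&
           [forall j, [|| j == i, j \in r' | s j == ord0]])
      \prod_(j <- r') F j (s j) = \prod_(j <- r') \sum_(b < (d j).+1) F j b.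
  have ir : i \notin r by rewrite mem_filter eqxx.
  rewrite -(big_filter (index_enum 'I_N)) -/r -(key r ur ir).
  apply: eq_big => [s|s _]; last by rewrite -(big_filter (index_enum 'I_N)).
  rewrite -[LHS]andbT; congr (_ && _).
  symmetry; apply/forallP => j; rewrite mem_filter mem_index_enum andbT.
  by case: (j == i).
elim: r' => [|k r' IHr] /=.
  move=> _ _; rewrite big_nil.
  pose s0 : strategy_profile d := update_profile [ffun j => @ord0 (d j)] a.
  rewrite (big_pred1 s0) ?big_nil // => s; apply/andP/eqP => [[/eqP sia /forallP s0']|->].
    apply/ffunP => j; have [->|neq] := eqVneq j i; first by rewrite update_profile_in.
    rewrite update_profile_out // ffunE; apply/eqP.
    by have := s0' j; rewrite (negPf neq) /=.
  split; first by rewrite update_profile_in.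
  apply/forallP => j; have [//|neq /=] := eqVneq j i.
  by rewrite update_profile_out // ffunE.
move=> /andP[kr' ur'] ; rewrite inE negb_or => /andP[neq_ik ir'].
rewrite (big_update_profile (j := k)); last first.
  move=> s b; rewrite update_profile_out //; congr (_ && _).
  apply: eq_forallb => j; have [->|neq] := eqVneq j k.
    by rewrite !inE eqxx !orbT.
  by rewrite update_profile_out.
rewrite big_cons -(IHr ur' ir') mulr_sumr; apply: eq_big => [s|s _].
  rewrite -andbA; congr (_ && _); apply/andP/forallP => [[/forallP s0 /eqP sk] j|s0].
    have := s0 j; rewrite inE; have [->|neq] := eqVneq j k; last by [].
    by rewrite sk eqxx !orbT.
  split; last by have := s0 k; rewrite eq_sym (negPf neq_ik) (negPf kr').
  apply/forallP => j; rewrite inE; have := s0 j.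
  by case/or3P => ->; rewrite ?orbT.
rewrite mulr_suml; apply: eq_bigr => b _.
rewrite big_cons update_profile_in; congr (_ * _).
rewrite !big_seq; apply: eq_bigr => j jr'; rewrite update_profile_out //.
by apply: contraNneq kr' => <-.
Qed.

End DependentProducts.

(** * Block degrees of the equations *)

Section QuasiPoly.

Variables (N : nat) (d : 'I_N -> nat).

Lemma sum_sigma (R : nzRingType) (j : 'I_N) : \sum_(a < (d j).+1) sigma R a = 1.
Proof.
rewrite big_ord_recl {1}/sigma unlift_none.
under [X in _ + X]eq_bigr do rewrite /sigma liftK.
by rewrite subrK.
Qed.

(* The variables of a player j that i does not watch drop out because u_i does
   not depend on s_j and the sigma_j(s_j) sum to 1.                            *)
Lemma payoff_poly_bounded (R : comNzRingType) (gamma : rel 'I_N) (u : game R d) i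
    (a : 'I_(d i).+1) :
  obeys gamma u -> block_bounded (fun j => (gamma i j && (j != i) : nat)) (payoff_poly u a).
Proof.
move=> obs.
(* The unwatched players are eliminated one at a time: their strategies are fixed at [ord0] and
   their factors leave the product. *)
suff key (r : seq 'I_N) : uniq r -> i \notin r -> all (fun j => ~~ gamma i j) r ->
    payoff_poly u a = \sum_(s : strategy_profile d | (s i == a) &&
        all (fun j => s j == ord0) r)
      (u i s)%:MP * \prod_(j < N | (j != i) && (j \notin r)) sigma R (s j).
  pose r := [seq j <- index_enum 'I_N | ~~ gamma i j & j != i].
  have inr j : (j \in r) = ~~ gamma i j && (j != i).
    by rewrite mem_filter mem_index_enum andbT.
  rewrite (key r); first last.
  - by apply/allP => j; rewrite inr => /andP[].
  - by rewrite inr eqxx andbF.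
  - by rewrite filter_uniq ?index_enum_uniq.
  apply: block_bounded_sum => s _.
  have := block_boundedM (@block_boundedC N d R (fun=> 0%N) (u i s))
    (block_bounded_prod (r := index_enum 'I_N) (P := fun j => (j != i) && (j \notin r))
      (fun j _ => @block_bounded_sigma N d R j (s j))).
  apply: block_boundedW => j; rewrite add0n.
  under eq_bigr => k _ do rewrite eq_sym.
  rewrite -big_mkcondr /=.
  have [//|ne] := eqVneq j i.
    move=> ->; rewrite andbF big_pred0 // => k.
    by case: eqVneq => [->|]; rewrite ?eqxx ?andbF.
  case: (boolP (gamma i j)) => gij /=.
    by rewrite big_mkcondl big_pred1_eq; case: ifP.
  rewrite big_pred0 // => k; have [->|_] := eqVneq k j; last by rewrite andbF.
  by rewrite inr gij ne.
elim: r => [|k r IHr] /=.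
  move=> _ _ _; apply: eq_big => [s|s _]; first by rewrite andbT.
  by congr (_ * _); apply: eq_bigl => j; rewrite andbT.
move=> /andP[kr ur]; rewrite inE negb_or => /andP[neq_ik ir] /andP[gik gr].
rewrite IHr // (big_update_profile (j := k)); last first.
  move=> s b; rewrite update_profile_out //; congr (_ && _).
  apply: eq_in_all => j jr; rewrite update_profile_out //.
  by apply: contraNneq kr => <-.
apply: eq_big => [s|s /andP[/andP[_ _] /eqP sk]].
  by rewrite -andbA [all _ _ && _]andbC.
rewrite (eq_bigr (fun b => (u i s)%:MP *
    (sigma R b * \prod_(j | (j != i) && (j \notin k :: r)) sigma R (s j)))).
  by rewrite -mulr_sumr -mulr_suml sum_sigma mul1r.
move=> b _; congr (_ * _).
  congr mpolyC; apply: obs => [|j ne_ji gij]; rewrite update_profile_out //.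
  by apply: contraTneq gij => ->.
rewrite (bigD1 k) /=; last by rewrite eq_sym neq_ik kr.
rewrite update_profile_in; congr (_ * _).
apply: eq_big => [j|j /andP[_ neq]].
  by rewrite inE negb_or -andbA [(j \notin r) && _]andbC.
by rewrite update_profile_out.
Qed.

(** Conclusions (1), (2) and (3) of the theorem are all read off this bound, which also controls the
    supports in the elimination. *)
Lemma quasi_poly_bounded (R : comNzRingType) (gamma : rel 'I_N) (u : game R d)
    (x : node d) :
  obeys gamma u ->
  block_bounded (fun j => (gamma (tag x) j && (j != tag x) : nat)) (quasi_poly u x).
Proof. by move=> obs; apply: block_boundedB; apply: payoff_poly_bounded. Qed.

End QuasiPoly.

(** * Elimination by a determinant *)

Section Monomials.

Variables (N : nat) (d : 'I_N -> nat).
Local Notation n := #|{: node d}|.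

(** An exponent is at most its block degree, so all candidates are found among the functions into
    ['I_b.+1]. This finite list indexes the matrix of the elimination. *)
Definition block_monomials (b : nat) : seq 'X_{1..n} :=
  undup [seq e <- [seq [multinom (f i : nat) | i < n] | f : {ffun 'I_n -> 'I_b.+1}]
        | [forall j, block_degree e j <= b]%N].

Lemma block_monomials_uniq b : uniq (block_monomials b).
Proof. exact: undup_uniq. Qed.

Lemma mem_block_monomials b e :
  (e \in block_monomials b) = [forall j, block_degree e j <= b]%N.
Proof.
rewrite mem_undup mem_filter; case: forallP => //= be.
apply/mapP; exists [ffun i => inord (e i)]; first by rewrite mem_enum.
apply/mnmP => i; rewrite mnmE ffunE inordK // ltnS.
apply: leq_trans (be (tag (enum_val i))).
by have := var_exponent_le e (enum_val i); rewrite /var_exponent enum_valK.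
Qed.

Lemma msupp_block_bounded (R : nzRingType) b (p : {mpoly R[n]}) :
  block_bounded (fun=> b) p -> {subset msupp p <= block_monomials b}.
Proof. by move=> bp e /bp be; rewrite mem_block_monomials; apply/forallP. Qed.

End Monomials.

Lemma mpoly_sum_over (n : nat) (R : nzRingType) (s : seq 'X_{1..n})
    (p : {mpoly R[n]}) : uniq s -> {subset msupp p <= s} ->
  p = \sum_(i < size s) p@_(nth 0%MM s i) *: 'X_[nth 0%MM s i].
Proof.
move=> us ps; rewrite -(big_mkord xpredT (fun i => p@_(nth 0%MM s i) *: 'X_[nth 0%MM s i])).
rewrite -(big_nth 0%MM xpredT (fun e => p@_e *: 'X_[e])) {1}[p]mpolyE.
rewrite [RHS](bigID (mem (msupp p))) /= [X in _ + X]big1 ?addr0 => [|e]; last first.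
  by move=> /memN_msupp_eq0 ->; rewrite scale0r.
rewrite -[RHS]big_filter; apply/perm_big/uniq_perm; rewrite ?filter_uniq ?msupp_uniq //.
by move=> e; rewrite mem_filter andb_idr //; apply: ps.
Qed.

(** * Change of the coefficient ring *)

Section MapQuasiPoly.

Variables (A B : comNzRingType) (f : {rmorphism A -> B}) (N : nat) (d : 'I_N -> nat).

Lemma map_sigma (j : 'I_N) (a : 'I_(d j).+1) : map_mpoly f (sigma A a) = sigma B a.
Proof.
rewrite /sigma; case: unliftP => [l _|_]; first exact: map_mpolyX.
rewrite rmorphB rmorph1 rmorph_sum; congr (_ - _).
by apply: eq_bigr => l _; apply: map_mpolyX.
Qed.

Lemma map_payoff_poly (u : game A d) i (a : 'I_(d i).+1) :
  map_mpoly f (payoff_poly u a) = payoff_poly (fun i s => f (u i s)) a.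
Proof.
rewrite /payoff_poly rmorph_sum; apply: eq_bigr => s _.
rewrite rmorphM rmorph_prod /= map_mpolyC; congr (_ * _).
by apply: eq_bigr => j _; apply: map_sigma.
Qed.

Lemma map_quasi_poly (u : game A d) x :
  map_mpoly f (quasi_poly u x) = quasi_poly (fun i s => f (u i s)) x.
Proof. by rewrite rmorphB /= !map_payoff_poly. Qed.

End MapQuasiPoly.

Lemma map_mpoly_ext (A B : nzRingType) (f g : A -> B) n (p : {mpoly A[n]}) :
  f =1 g -> map_mpoly f p = map_mpoly g p.
Proof.
move=> fg; rewrite /map_mpoly /mmap; apply: eq_bigr => e _ /=.
by rewrite fg.
Qed.

Lemma map_mpoly_id (A : nzRingType) n (p : {mpoly A[n]}) : map_mpoly idfun p = p.
Proof. by apply/mpolyP => e; rewrite mcoeff_map_mpoly. Qed.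

Lemma map_mpoly_compE (A B C : comNzRingType) (f : {rmorphism A -> B})
    (g : {rmorphism B -> C}) n (p : {mpoly A[n]}) :
  map_mpoly g (map_mpoly f p) = map_mpoly (g \o f) p.
Proof. by apply/mpolyP => e; rewrite !mcoeff_map_mpoly. Qed.

Lemma rmorph_meval (A B : comNzRingType) (f : {rmorphism A -> B}) n
    (p : {mpoly A[n]}) (z : 'I_n -> A) (w : 'I_n -> B) : (forall i, w i = f (z i)) ->
  f p.@[z] = (map_mpoly f p).@[w].
Proof.
move=> wz; rewrite [p]mpolyE (raddf_sum (meval z)) (rmorph_sum f) (raddf_sum (map_mpoly f)).
rewrite (raddf_sum (meval w)) /=; apply: eq_bigr => e _.
rewrite map_mpolyZ map_mpolyX !mevalZ rmorphM /= !mevalX rmorph_prod; congr (_ * _).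
by apply: eq_bigr => i _; rewrite rmorphXn wz.
Qed.

Section Elimination.

Variables (R : comNzRingType) (N : nat) (d : 'I_N -> nat).
Local Notation n := #|{: node d}|.
Variables (s : seq 'X_{1..n}) (D : nat) (g : 'I_(size s) -> node d -> {mpoly R[n]}).
Variables (b : 'M[R]_(size s, D)) (L : {mpoly R[n]}).

Section Defs.

Variables (A : comNzRingType) (iota : {rmorphism R -> A}).
Implicit Types u : game A d.

(* In the application the monomials of s satisfy
     s_i = \sum_x g i x * quasi_poly u0 x + \sum_(k < D) b i k *: L ^+ k
   for a special game u0. Replacing u0 by u makes the right-hand side drift away
   from s_i; elim_mx records its coefficients on s, and multiplying by the
   adjugate gives back elim_lead u *: s_i modulo the quasi_poly u x, as a
   combination of the powers of L.                                             *)
Definition elim_poly u i : {mpoly A[n]} :=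
  \sum_x map_mpoly iota (g i x) * quasi_poly u x +
  \sum_(k < D) iota (b i k) *: map_mpoly iota L ^+ k.

Definition elim_mx u : 'M[A]_(size s) :=
  \matrix_(i, j) (elim_poly u i)@_(nth 0%MM s j).

Definition elim_rep u i : {poly A} :=
  \sum_(k < D) (\adj (elim_mx u) *m map_mx iota b) i k *: 'X^k.

Definition elim_of u (p : {mpoly R[n]}) : {poly A} :=
  \sum_(i < size s) iota p@_(nth 0%MM s i) *: elim_rep u i.

Definition elim_lead u : A := \det (elim_mx u).

(** The polynomial Q_u: L^D is itself reduced to lower powers of L, so every solution makes L a
    root. *)
Definition elim_eliminant u : {poly A} :=
  elim_lead u *: 'X^D - elim_of u (L ^+ D).

Lemma size_elim_of u p : (size (elim_of u p) <= D)%N.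
Proof.
have size_sum_le m (F : 'I_m -> {poly A}) :
    (forall i, size (F i) <= D)%N -> (size (\sum_(i < m) F i)%R <= D)%N.
  by move=> FD; apply: leq_trans (size_sum _ _ _) _; apply/bigmax_leqP.
apply: (size_sum_le) => i; apply: leq_trans (size_scale_leq _ _) _.
apply: size_sum_le => k; apply: leq_trans (size_scale_leq _ _) _.
by rewrite size_polyXn.
Qed.

Lemma elim_ofP u p z : uniq s ->
  (forall i, {subset msupp (elim_poly u i) <= s}) -> {subset msupp p <= s} ->
  exists err : node d -> A, elim_lead u * (map_mpoly iota p).@[z] =
    (elim_of u p).[(map_mpoly iota L).@[z]] + \sum_x err x * (quasi_poly u x).@[z].
Proof.
move=> us us_elim ps.
pose v := \col_(i < size s) ('X_[nth 0%MM s i] : {mpoly A[n]}).@[z].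
have Tv : elim_mx u *m v = \col_i (elim_poly u i).@[z].
  apply/colP => i; rewrite !mxE (mpoly_sum_over us (us_elim i)) (raddf_sum (meval z)) /=.
  by apply: eq_bigr => j _; rewrite !mxE mevalZ.
have {Tv} detv : elim_lead u *: v = \adj (elim_mx u) *m \col_i (elim_poly u i).@[z].
  by rewrite -Tv mulmxA mul_adj_mx mul_scalar_mx.
have vE i : elim_lead u * v i 0 = (elim_rep u i).[(map_mpoly iota L).@[z]] +
    \sum_x (\sum_j \adj (elim_mx u) i j * (map_mpoly iota (g j x)).@[z]) *
      (quasi_poly u x).@[z].
  have := congr1 (fun w : 'cV_(size s) => w i 0) detv; rewrite mxE => ->.
  rewrite mxE; under eq_bigr => j _ do rewrite [(\col_i _) _ _]mxE /elim_poly mevalD mulrDr.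
  rewrite big_split [RHS]addrC /=; congr (_ + _); last first.
    rewrite /elim_rep horner_sum.
    under [RHS]eq_bigr => k _ do rewrite hornerZ hornerXn !mxE mulr_suml.
    rewrite [RHS]exchange_big; apply: eq_bigr => j _.
    rewrite raddf_sum mulr_sumr /=; apply: eq_bigr => k _.
    by rewrite mevalZ rmorphXn !mxE mulrA.
  under [RHS]eq_bigr => x _ do rewrite mulr_suml.
  rewrite [RHS]exchange_big; apply: eq_bigr => j _.
  rewrite (raddf_sum (meval z)) mulr_sumr /=; apply: eq_bigr => x _.
  by rewrite mevalM mulrA.
exists (fun x => \sum_(i < size s) iota p@_(nth 0%MM s i) *
   \sum_j \adj (elim_mx u) i j * (map_mpoly iota (g j x)).@[z]).
rewrite {1}(mpoly_sum_over us ps) (raddf_sum (map_mpoly iota)) (raddf_sum (meval z)) mulr_sumr /=.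
rewrite /elim_of horner_sum.
under [X in _ = _ + X]eq_bigr => x _ do rewrite mulr_suml.
rewrite [X in _ = _ + X]exchange_big -big_split; apply: eq_bigr => i _ /=.
rewrite map_mpolyZ map_mpolyX mevalZ mulrCA.
have := vE i; rewrite mxE => ->; rewrite mulrDr hornerZ; congr (_ + _).
by rewrite mulr_sumr; apply: eq_bigr => x _; rewrite mulrA.
Qed.

End Defs.

Section Map.

Variables (A B : comNzRingType) (iota : {rmorphism R -> A}) (kappa : {rmorphism R -> B}).
Variables (f : {rmorphism A -> B}) (u : game A d) (v : game B d).
Hypotheses (f_iota : forall r, f (iota r) = kappa r)
  (f_u : forall i s, f (u i s) = v i s).

Let f_mpoly (p : {mpoly R[n]}) : map_mpoly f (map_mpoly iota p) = map_mpoly kappa p.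
Proof. by rewrite map_mpoly_compE; apply: map_mpoly_ext. Qed.

Let f_quasi x : map_mpoly f (quasi_poly u x) = quasi_poly v x.
Proof.
rewrite map_quasi_poly /quasi_poly /payoff_poly.
by congr (_ - _); apply: eq_bigr => t _; rewrite f_u.
Qed.

(** Compatibility with morphisms links the versions of the elimination over the reals, the complex
    numbers, the ring of the line and the ring of polynomials in the payoffs. *)
Lemma map_elim_poly i : map_mpoly f (elim_poly iota u i) = elim_poly kappa v i.
Proof.
rewrite /elim_poly rmorphD /= !(raddf_sum (map_mpoly f)) /=.
congr (_ + _); apply: eq_bigr => x _ /=.
  by rewrite rmorphM /= f_mpoly f_quasi.
by rewrite map_mpolyZ rmorphXn /= f_mpoly f_iota.
Qed.

Lemma map_elim_mx : map_mx f (elim_mx iota u) = elim_mx kappa v.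
Proof. by apply/matrixP => i j; rewrite !mxE -map_elim_poly mcoeff_map_mpoly. Qed.

Lemma map_elim_lead : f (elim_lead iota u) = elim_lead kappa v.
Proof. by rewrite -det_map_mx map_elim_mx. Qed.

Lemma map_elim_of p : map_poly f (elim_of iota u p) = elim_of kappa v p.
Proof.
rewrite rmorph_sum; apply: eq_bigr => i _ /=; rewrite map_polyZ f_iota rmorph_sum.
congr (_ *: _); apply: eq_bigr => k _ /=; rewrite map_polyZ map_polyXn; congr (_ *: _).
have -> : map_mx kappa b = map_mx f (map_mx iota b).
  by apply/matrixP => i' k'; rewrite !mxE f_iota.
by rewrite -map_elim_mx -map_mx_adj -map_mxM [RHS]mxE.
Qed.

Lemma map_elim_eliminant :
  map_poly f (elim_eliminant iota u) = elim_eliminant kappa v.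
Proof.
by rewrite rmorphB /= map_polyZ map_polyXn map_elim_lead map_elim_of.
Qed.

End Map.

End Elimination.

(** * Approximate roots *)

Section Approximation.

Variable F : fieldType.

Lemma dvd_Xn_small (p : {poly F}) : (forall m, 'X^m %| p) -> p = 0.
Proof.
move=> Xp; apply: contraTeq (Xp (size p)) => p0; apply/negP => /(dvdp_leq p0).
by rewrite size_polyXn ltnn.
Qed.

Lemma prod_congr (I : Type) (r : seq I) (P : pred I) (G H : I -> {poly F}) h :
  (forall i, P i -> h %| G i - H i) ->
  h %| \prod_(i <- r | P i) G i - \prod_(i <- r | P i) H i.
Proof.
move=> GH; elim/big_rec2: _ => [|i a b Pi h_ab]; first by rewrite subrr dvdp0.
have -> : G i * b - H i * a = G i * (b - a) + (G i - H i) * a.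
  by rewrite mulrBr mulrBl addrA subrK.
by apply: dvdp_add; [exact: dvdp_mull | apply/dvdp_mulr/GH].
Qed.

Lemma meval_congr n (p : {mpoly {poly F}[n]}) (h : {poly F}) z w :
  (forall i, h %| z i - w i) -> h %| p.@[z] - p.@[w].
Proof.
move=> zw; rewrite [p]mpolyE (raddf_sum (meval z)) (raddf_sum (meval w)) -sumrB.
elim/big_ind: _ => [|p1 p2|e _]; [exact: dvdp0|exact: dvdp_add|].
rewrite /= !mevalZ -mulrBr; apply: dvdp_mull.
rewrite !mevalX; apply: prod_congr => i _.
by rewrite subrXX dvdp_mulr.
Qed.

(** If Y = X^m Z, approximate roots of order m+1 show that Z modulo X vanishes at the D distinct
    points [t0 c], too many for its degree. Hence X divides Z, and inductively every power of X
    divides the coefficients of Y. *)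
Lemma poly_approx_roots0 (D : nat) (t0 : 'I_D -> F) (Y : {poly {poly F}}) :
  injective t0 -> (size Y <= D)%N ->
  (forall m, exists t : 'I_D -> {poly F},
     forall c, (t c).[0] = t0 c /\ 'X^m %| Y.[t c]) ->
  Y = 0.
Proof.
move=> t0_inj sY approx.
suff XY m : exists Z : {poly {poly F}}, (size Z <= D)%N /\ Y = 'X^m *: Z.
  apply/polyP => k; rewrite coef0; apply: dvd_Xn_small => m.
  by have [Z [_ ->]] := XY m; rewrite coefZ dvdp_mulr.
elim: m => [|m [Z [sZ YE]]]; first by exists Y; rewrite expr0 scale1r.
have [t tP] := approx m.+1.
have Z0 : map_poly (horner_eval 0) Z = 0.
  apply: (@roots_geq_poly_eq0 _ _ (codom t0)).
  - apply/allP => _ /codomP[c ->]; have [tc0] := tP c.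
    rewrite YE hornerZ exprSr dvdp_mul2l ?monic_neq0 ?monicXn // => dvdX.
    rewrite /root -tc0 -[(t c).[0]]/(horner_eval 0 (t c)) horner_map /=.
    move: dvdX; rewrite -['X]subr0 -polyC0 dvdp_XsubCl => /rootP.
    by rewrite /horner_eval => ->.
  - by rewrite map_inj_uniq ?enum_uniq.
  - by rewrite size_codom card_ord (leq_trans (size_poly _ _)).
exists (\poly_(k < D) (Z`_k %/ 'X)); split; first exact: size_poly.
rewrite YE exprSr -scalerA; congr (_ *: _); apply/polyP => k.
rewrite coefZ coef_poly; case: ltnP => kD; last first.
  by rewrite mulr0 nth_default // (leq_trans sZ).
rewrite mulrC divpK // -['X]subr0 -polyC0 dvdp_XsubCl.
have := congr1 (fun q : {poly F} => q`_k) Z0; rewrite coef_map coef0 /= /horner_eval.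
by move/rootP.
Qed.

(** The pseudo-remainder of Y by Q has degree less than D and the same approximate roots, so it is
    zero. The power of the leading coefficient is that of the pseudo-division. *)
Lemma poly_approx_dvd (D : nat) (t0 : 'I_D -> F) (Q Y : {poly {poly F}}) :
  injective t0 -> size Q = D.+1 ->
  (forall m, exists t : 'I_D -> {poly F},
     forall c, [/\ (t c).[0] = t0 c, 'X^m %| Q.[t c] & 'X^m %| Y.[t c]]) ->
  exists k S, lead_coef Q ^+ k *: Y = S * Q.
Proof.
move=> t0_inj sQ approx; exists (scalp Y Q), (Y %/ Q).
have Q0 : Q != 0 by rewrite -size_poly_eq0 sQ.
rewrite Pdiv.Idomain.divp_eq -[RHS]addr0; congr (_ + _).
apply: (poly_approx_roots0 t0_inj) => [|m]; first by rewrite -ltnS -sQ ltn_modp.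
have [t tP] := approx m; exists t => c; have [-> XQ XY] := tP c; split=> //.
have -> : Y %% Q = lead_coef Q ^+ scalp Y Q *: Y - Y %/ Q * Q.
  by rewrite Pdiv.Idomain.divp_eq addrC addKr.
by rewrite hornerD hornerN hornerZ hornerM dvdp_sub ?dvdp_mull -?mul_polyC ?dvdp_mull.
Qed.

End Approximation.

(** * Clearing denominators *)

Section Homogenize.

Variables (n : nat) (s : seq 'X_{1..n}).

(** The elimination yields coordinates only up to a common factor [c]; at the point [c * z] this
    polynomial takes the value of [p] at [z] times [c ^+ K], as soon as [K] bounds the total degrees
    in [s]. *)
Definition homogenize (A : comNzRingType) (K : nat) (c : A) (p : {mpoly A[n]}) :
    {mpoly A[n]} :=
  \sum_(i < size s) (p@_(nth 0%MM s i) * c ^+ (K - mdeg (nth 0%MM s i))) *: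
    'X_[nth 0%MM s i].

Lemma meval_homogenize (A : comNzRingType) K (c : A) p z : uniq s ->
  {subset msupp p <= s} -> (forall e, e \in s -> mdeg e <= K)%N ->
  (homogenize K c p).@[fun i => c * z i] = c ^+ K * p.@[z].
Proof.
move=> us ps sK; rewrite {2}(mpoly_sum_over us ps) !(raddf_sum (meval _)) mulr_sumr.
apply: eq_bigr => i _ /=; rewrite !mevalZ !mevalX.
under eq_bigr => j _ do rewrite exprMn.
rewrite big_split /= prodrXr -mdegE [RHS]mulrCA -mulrA; congr (_ * _).
by rewrite mulrA -exprD subnK // sK // mem_nth.
Qed.

Lemma map_homogenize (A B : comNzRingType) (f : {rmorphism A -> B}) K c p :
  map_mpoly f (homogenize K c p) = homogenize K (f c) (map_mpoly f p).
Proof.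
rewrite (raddf_sum (map_mpoly f)); apply: eq_bigr => i _.
by rewrite /= map_mpolyZ map_mpolyX rmorphM rmorphXn /= mcoeff_map_mpoly.
Qed.

End Homogenize.

(* map_resultant has this for morphisms out of a polynomial ring only. *)
Lemma rmorph_resultant (A B : nzRingType) (f : {rmorphism A -> B}) (p q : {poly A}) :
  f (lead_coef p) != 0 -> f (lead_coef q) != 0 ->
  f (resultant p q) = resultant (map_poly f p) (map_poly f q).
Proof.
move=> fp fq; have := @Sylvester_mxE _ (map_poly f p) (map_poly f q).
rewrite /resultant; move: (Sylvester_mx (map_poly f p) _).
rewrite !size_map_poly_id0 // => S SE; rewrite -det_map_mx; congr (\det _).
apply/matrixP => i j; rewrite mxE Sylvester_mxE SE.
by case: split => k; rewrite rmorphMn coef_map.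
Qed.

Section Eliminants.

Variable A : idomainType.

Lemma size_scaleXnB (c : A) D (q : {poly A}) : c != 0 -> (size q <= D)%N ->
  size (c *: 'X^D - q) = D.+1.
Proof.
move=> c0 qD; have sX : size (c *: 'X^D) = D.+1 by rewrite size_scale ?size_polyXn.
by rewrite size_polyDl ?size_polyN sX.
Qed.

Lemma lead_coef_scaleXnB (c : A) D (q : {poly A}) : c != 0 -> (size q <= D)%N ->
  lead_coef (c *: 'X^D - q) = c.
Proof.
move=> c0 qD; have sX : size (c *: 'X^D) = D.+1 by rewrite size_scale ?size_polyXn.
by rewrite lead_coefDl ?size_polyN ?sX // lead_coefZ lead_coefXn mulr1.
Qed.

Lemma lead_coef_shift_add (Q q : {poly A}) (M : nat) : Q != 0 -> (size q <= M)%N ->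
  lead_coef ('X^M * Q + q) = lead_coef Q.
Proof.
move=> Q0 qM; rewrite lead_coefDl ?lead_coefM ?lead_coefXn ?mul1r //.
have X0 : 'X^M != 0 :> {poly A} by rewrite monic_neq0 ?monicXn.
rewrite (size_mul X0 Q0) size_polyXn addSn /=.
by rewrite -addn1 leq_add ?size_poly_gt0.
Qed.

End Eliminants.

(** * Counting solutions by the roots of the eliminant *)

(** The line through the two games, with the polynomial variable as parameter: [u0] at 0 and [u] at
    1. *)
Definition line_game (R : comNzRingType) (N : nat) (d : 'I_N -> nat)
    (u0 u : game R d) : game {poly R} d :=
  fun i s => (u0 i s)%:P + (u i s - u0 i s)%:P * 'X.

Lemma obeys_line_game (R : comNzRingType) (N : nat) (d : 'I_N -> nat)
    (gamma : rel 'I_N) (u0 u : game R d) :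
  obeys gamma u0 -> obeys gamma u -> obeys gamma (line_game u0 u).
Proof.
move=> obs0 obs i s t st gst; rewrite /line_game.
by rewrite (obs0 i s t) // (obs i s t).
Qed.

Lemma obeys_map (A B : Type) (f : A -> B) (N : nat) (d : 'I_N -> nat)
    (gamma : rel 'I_N) (u : game A d) :
  obeys gamma u -> obeys gamma (fun i s => f (u i s)).
Proof. by move=> obs i s t st gst; rewrite (obs i s t). Qed.

Lemma block_bounded_map (A B : comNzRingType) (f : {rmorphism A -> B}) (N : nat)
    (d : 'I_N -> nat) b (p : {mpoly A[#|{: node d}|]}) :
  block_bounded b p -> block_bounded b (map_mpoly f p).
Proof.
move=> bp e; rewrite mcoeff_msupp mcoeff_map_mpoly => fe0.
by apply: bp; rewrite mcoeff_msupp; apply: contraNneq fe0 => ->; rewrite raddf0.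
Qed.

Section Counting.

Variables (R : realType) (N : nat) (d : 'I_N -> nat) (gamma : rel 'I_N).
Local Notation n := #|{: node d}|.
Variables (B D : nat) (u0 : game R d).
Local Notation s := (block_monomials d B).
Variables (g : 'I_(size s) -> node d -> {mpoly R[n]}) (b : 'M[R]_(size s, D)).
Variables (lambda : node d -> R) (zc : 'I_D -> node d -> R).
Let L : {mpoly R[n]} := \sum_y lambda y *: sigma_var R y.
Let point (c : 'I_D) : 'I_n -> R := fun i => zc c (enum_val i).
Let Lc (c : 'I_D) : R := L.@[point c].

(** Data of the special game [u0]: D solutions with nonzero coordinates, a linear form separating
    them, liftings along every line, and a reduction of each monomial to powers of [L] with
    multipliers of controlled degree. *)
Hypotheses (B_gt0 : (0 < B)%N) (D_le_B : (D <= B)%N) (obs0 : obeys gamma u0).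
Hypothesis reprE : forall i : 'I_(size s), 'X_[nth 0%MM s i] =
  \sum_x g i x * quasi_poly u0 x + \sum_(k < D) b i k *: L ^+ k.
Hypothesis g_bounded : forall i x,
  block_bounded (fun j => B - gamma (tag x) j)%N (g i x).
Hypotheses (Lc_inj : injective Lc) (zc_neq0 : forall c y, zc c y != 0).
Hypothesis point_sol : forall c x, (quasi_poly u0 x).@[point c] = 0.
Hypothesis lift_points : forall u, obeys gamma u -> forall m c,
  exists z : 'I_n -> {poly R}, (forall i, (z i).[0] = point c i) /\
    forall x, 'X^m %| (quasi_poly (line_game u0 u) x).@[z].

Let us : uniq s := block_monomials_uniq d B.

Let L_bounded : block_bounded (fun=> 1%N) L.
Proof.
by apply: block_bounded_sum => y _; apply/block_boundedZ/block_bounded_var.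
Qed.

Let L_eval (A : comNzRingType) (f : {rmorphism R -> A}) z :
  (map_mpoly f L).@[z] = \sum_y f (lambda y) * z (enum_rank y).
Proof.
rewrite /L (raddf_sum (map_mpoly f)) (raddf_sum (meval z)).
by apply: eq_bigr => y _; rewrite /= map_mpolyZ map_mpolyX mevalZ mevalXU.
Qed.

Let Lpow_bounded k : (k <= D)%N -> block_bounded (fun=> B) (L ^+ k).
Proof.
move=> kD; apply: block_boundedW (block_bounded_exp L_bounded) => j.
by rewrite muln1 (leq_trans kD).
Qed.

Let quasi_supp (A : comNzRingType) (u : game A d) x :
  obeys gamma u -> {subset msupp (quasi_poly u x) <= s}.
Proof.
move=> obs; apply: msupp_block_bounded.
apply: block_boundedW (quasi_poly_bounded (x := x) obs) => j.
by case: (_ && _).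
Qed.

(** The bound on [g i x] leaves room for one more factor [quasi_poly u x], whatever the game obeying
    [gamma]; so no monomial outside [s] appears and the matrix loses nothing. *)
Let elim_supp (A : comNzRingType) (iota : {rmorphism R -> A}) (u : game A d) i :
  obeys gamma u -> {subset msupp (elim_poly g b L iota u i) <= s}.
Proof.
move=> obs; apply: msupp_block_bounded; apply: block_boundedD.
  apply: block_bounded_sum => x _.
  apply: block_boundedW (block_boundedM (block_bounded_map (f := iota) (@g_bounded i x))
    (quasi_poly_bounded (x := x) obs)) => j.
  case: (gamma (tag x) j); rewrite ?subn0 ?addn0 //=.
  by case: (j != tag x); rewrite ?addn0 ?leq_subr // subnK.
apply: block_bounded_sum => k _; apply: block_boundedZ; rewrite -rmorphXn /=.
by apply/block_bounded_map/Lpow_bounded/ltnW.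
Qed.

Let K : nat := (\sum_(e <- s) mdeg e)%N.

Let mdeg_le e : e \in s -> (mdeg e <= K)%N.
Proof. by move=> es; rewrite /K (big_rem e) //= leq_addr. Qed.

Section Evaluate.

Variables (A : comNzRingType) (iota : {rmorphism R -> A}) (u : game A d).
Hypothesis obs : obeys gamma u.

Definition lead_at := elim_lead g b L iota u.
Definition eliminant_at := elim_eliminant g b L iota u.
Definition coord_at (y : 'I_n) := elim_of g b L iota u 'X_y.

Lemma coord_atP z : exists err : 'I_n -> node d -> A,
  forall y, lead_at * z y = (coord_at y).[(map_mpoly iota L).@[z]] +
    \sum_x err y x * (quasi_poly u x).@[z].
Proof.
have err y := elim_ofP (p := 'X_y) z us (fun i => @elim_supp A iota u i obs).
have Xs y : {subset msupp ('X_y : {mpoly R[n]}) <= s}.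
  apply: msupp_block_bounded; rewrite -[y]enum_valK.
  exact: (@block_bounded_var N d R (fun=> B) (enum_val y)).
have /fin_all_exists[e eP] y : exists e : {ffun node d -> A}, lead_at * z y =
  (coord_at y).[(map_mpoly iota L).@[z]] + \sum_x e x * (quasi_poly u x).@[z].
  have [e eP] := err y (Xs y); exists [ffun x => e x].
  move: eP; rewrite map_mpolyX mevalXU => ->; congr (_ + _).
  by apply: eq_bigr => x _; rewrite ffunE.
by exists e.
Qed.

Lemma eliminant_atP z : exists err : node d -> A,
  eliminant_at.[(map_mpoly iota L).@[z]] = \sum_x err x * (quasi_poly u x).@[z].
Proof.
have [err] := elim_ofP z us (fun i => @elim_supp A iota u i obs)
  (msupp_block_bounded (Lpow_bounded (leqnn D))).
rewrite !rmorphXn /= => errE; exists err.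
by rewrite /eliminant_at /elim_eliminant hornerD hornerN hornerZ hornerXn errE addrC addKr.
Qed.

End Evaluate.

Lemma elim_mx_special : elim_mx g b L idfun u0 = 1%:M.
Proof.
apply/matrixP => i j; rewrite !mxE /elim_poly.
under eq_bigr => x _ do rewrite map_mpoly_id.
under [X in _ + X]eq_bigr => k _ do rewrite map_mpoly_id /=.
by rewrite -reprE mcoeffX nth_uniq.
Qed.

Lemma lead_at_special : lead_at idfun u0 = 1.
Proof. by rewrite /lead_at /elim_lead elim_mx_special det1. Qed.

Section Generic.

Variable u : game R d.
Hypothesis obs : obeys gamma u.
Let v := line_game u0 u.
Let obsv : obeys gamma v := obeys_line_game obs0 obs.

Let iota : {rmorphism R -> {poly R}} := polyC.

Lemma lead_at_line : (lead_at iota v).[0] = 1.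
Proof.
rewrite -lead_at_special -[LHS]/(horner_eval 0 _) /lead_at.
apply: map_elim_lead => [r|i t] /=; rewrite /horner_eval ?hornerC //.
by rewrite /v /line_game !hornerE.
Qed.

Lemma lead_at_line_neq0 : lead_at iota v != 0.
Proof.
by apply: contra_eq_neq lead_at_line => ->; rewrite horner0 eq_sym oner_neq0.
Qed.

(* The D approximate solutions over the line are pairwise distinct modulo X, so a
   polynomial vanishing at all of them to every order is a multiple of the
   eliminant, up to a power of the leading coefficient.                        *)
Lemma eliminant_at_line_dvd (Y : {poly {poly R}}) :
  (forall m z, (forall x, 'X^m %| (quasi_poly v x).@[z]) ->
    'X^m %| Y.[(map_mpoly iota L).@[z]]) ->
  exists k S, lead_at iota v ^+ k *: Y = S * eliminant_at iota v.
Proof.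
move=> Yz.
have sE : size (eliminant_at iota v) = D.+1.
  by rewrite size_scaleXnB ?lead_at_line_neq0 ?size_elim_of.
have lE : lead_coef (eliminant_at iota v) = lead_at iota v.
  by rewrite lead_coef_scaleXnB ?lead_at_line_neq0 ?size_elim_of.
rewrite -lE; apply: (poly_approx_dvd Lc_inj sE) => m.
have /fin_all_exists[z zP] c : exists z : {ffun 'I_n -> {poly R}},
    (forall i, (z i).[0] = point c i) /\ forall x, 'X^m %| (quasi_poly v x).@[z].
  have [z [z0 zm]] := lift_points obs m c; exists [ffun i => z i].
  split=> [i|x]; first by rewrite ffunE.
  by rewrite (meval_eq _ (ffunE z)).
exists (fun c => (map_mpoly iota L).@[z c]) => c; have [z0 zm] := zP c; split.
- rewrite -[LHS]/(horner_eval 0 _) (@rmorph_meval _ _ _ _ _ _ (point c)); last first.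
    by move=> i; rewrite /= /horner_eval z0.
  rewrite map_mpoly_compE /Lc; congr _.@[_]; apply/mpolyP => e.
  by rewrite mcoeff_map_mpoly /= /horner_eval hornerC.
- have [err errE] := eliminant_atP iota obsv (z c); rewrite errE.
  elim/big_ind: _ => [|? ?|x _]; [exact: dvdp0|exact: dvdp_add|exact: dvdp_mull].
- exact: Yz.
Qed.

(** Up to a power of the leading factor, this is f_x at the point built from a value of L, as a
    polynomial in that value. *)
Definition solution_at (A : comNzRingType) (kappa : {rmorphism R -> A}) (w : game A d)
    x : {poly A} :=
  (map_mpoly polyC (homogenize s K (lead_at kappa w) (quasi_poly w x))).@[coord_at kappa w].

(** Its vanishing at t says that [L] takes the value t at the point built from t, so that distinct
    roots give distinct points. *)
Definition separator_at (A : comNzRingType) (kappa : {rmorphism R -> A}) (w : game A d) :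
    {poly A} :=
  (map_mpoly (polyC \o kappa) L).@[coord_at kappa w] - lead_at kappa w *: 'X.

Lemma coord_at_line m z : (forall x, 'X^m %| (quasi_poly v x).@[z]) ->
  forall y, 'X^m %| (coord_at iota v y).[(map_mpoly iota L).@[z]] - lead_at iota v * z y.
Proof.
move=> zm y; have [err errE] := coord_atP iota obsv z; rewrite errE.
rewrite opprD addNKr -dvdpNr opprK.
elim/big_ind: _ => [|? ?|x _]; [exact: dvdp0|exact: dvdp_add|exact: dvdp_mull].
Qed.

(** At an approximate solution [z] the coordinate polynomials agree with [lead_at iota v * z y]
    modulo X^m, so the homogenized f_x agrees with a multiple of f_x at [z], which X^m divides. *)
Lemma solution_at_line x : exists k S,
  lead_at iota v ^+ k *: solution_at iota v x = S * eliminant_at iota v.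
Proof.
apply: eliminant_at_line_dvd => m z zm; set t := (_).@[z].
rewrite -[X in _ %| X]/(horner_eval t _)
  (@rmorph_meval _ _ _ _ _ _ (fun y => (coord_at iota v y).[t])) //.
rewrite map_mpoly_compE (@map_mpoly_ext _ _ _ idfun); last first.
  by move=> r /=; rewrite /horner_eval hornerC.
rewrite map_mpoly_id.
have := meval_congr (homogenize s K (lead_at iota v) (quasi_poly v x)) (coord_at_line zm).
rewrite meval_homogenize //; last exact: quasi_supp.
by rewrite dvdp_subl // dvdp_mull.
Qed.

Lemma separator_at_line : exists k S,
  lead_at iota v ^+ k *: separator_at iota v = S * eliminant_at iota v.
Proof.
apply: eliminant_at_line_dvd => m z zm; set t := (_).@[z].
rewrite hornerD hornerN hornerZ hornerX.
rewrite -[X in _ %| X - _]/(horner_eval t _)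
  (@rmorph_meval _ _ _ _ _ _ (fun y => (coord_at iota v y).[t])) //.
rewrite map_mpoly_compE (@map_mpoly_ext _ _ _ iota); last first.
  by move=> r /=; rewrite /horner_eval hornerC.
have := meval_congr (map_mpoly iota L) (coord_at_line zm).
congr (_ %| _ - _).
by rewrite /t !L_eval mulr_sumr; apply: eq_bigr => y _; rewrite mulrCA.
Qed.


Section Specialize.

Variables (C : idomainType) (kappa : {rmorphism R -> C}) (w : game C d).
Variable phi : {rmorphism {poly R} -> C}.
Hypotheses (phi_iota : forall r, phi (iota r) = kappa r)
  (phi_v : forall i t, phi (v i t) = w i t).

Let phi_lead : phi (lead_at iota v) = lead_at kappa w :=
  map_elim_lead _ _ _ phi_iota phi_v.

Let phi_eliminant : map_poly phi (eliminant_at iota v) = eliminant_at kappa w :=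
  map_elim_eliminant _ _ _ phi_iota phi_v.

Let phi_coord y : map_poly phi (coord_at iota v y) = coord_at kappa w y :=
  map_elim_of _ _ _ phi_iota phi_v _.

Let phi_quasi x : map_mpoly phi (quasi_poly v x) = quasi_poly w x.
Proof.
rewrite map_quasi_poly /quasi_poly /payoff_poly.
by congr (_ - _); apply: eq_bigr => t _; rewrite phi_v.
Qed.

(** The divisibility over the line is pushed forward by [phi]; the power of the leading factor is
    nonzero in the domain [C] and cancels. *)
Lemma solution_at_root x t : lead_at kappa w != 0 -> root (eliminant_at kappa w) t ->
  (solution_at kappa w x).[t] = 0.
Proof.
move=> lead0 /rootP rt; have [k [S SE]] := solution_at_line x.
have := congr1 (map_poly phi) SE; rewrite map_polyZ rmorphM rmorphXn /=.
rewrite phi_lead phi_eliminant.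
move/(congr1 (horner^~ t)); rewrite hornerM rt mulr0 hornerZ => /eqP.
rewrite mulf_eq0 expf_eq0 (negPf lead0) andbF /= => /eqP.
rewrite (@rmorph_meval _ _ _ _ _ _ (coord_at kappa w)); last first.
  by move=> y; rewrite /= phi_coord.
rewrite map_mpoly_compE (@map_mpoly_ext _ _ _ (polyC \o phi)); last first.
  by move=> r; rewrite /= map_polyC.
rewrite -map_mpoly_compE map_homogenize phi_lead.
by rewrite phi_quasi.
Qed.

Lemma separator_at_root t : lead_at kappa w != 0 -> root (eliminant_at kappa w) t ->
  (separator_at kappa w).[t] = 0.
Proof.
move=> lead0 /rootP rt; have [k [S SE]] := separator_at_line.
have := congr1 (map_poly phi) SE; rewrite map_polyZ rmorphM rmorphXn /=.
rewrite phi_lead phi_eliminant.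
move/(congr1 (horner^~ t)); rewrite hornerM rt mulr0 hornerZ => /eqP.
rewrite mulf_eq0 expf_eq0 (negPf lead0) andbF /= => /eqP.
rewrite rmorphB /= map_polyZ map_polyX phi_lead.
rewrite (@rmorph_meval _ _ _ _ _ _ (coord_at kappa w)); last first.
  by move=> y; rewrite /= phi_coord.
rewrite map_mpoly_compE (@map_mpoly_ext _ _ _ (polyC \o kappa)) //.
by move=> r; rewrite /= map_polyC /= phi_iota.
Qed.

End Specialize.

Let kappa : {rmorphism R -> R[i]} := real_complex R.
Let w : game R[i] d := fun i t => (u i t)%:C%C.
Let obsw : obeys gamma w := obeys_map (real_complex R) obs.
Let phi : {rmorphism {poly R} -> R[i]} := kappa \o horner_eval 1.

Let phi_iota r : phi (iota r) = kappa r.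
Proof. by rewrite /= /horner_eval hornerC. Qed.

Let phi_v i t : phi (v i t) = w i t.
Proof.
rewrite /phi /= /horner_eval /v /line_game hornerD hornerM hornerX !hornerC mulr1.
by rewrite addrC subrK.
Qed.

Let kappa_id r : kappa (idfun r) = kappa r. Proof. by []. Qed.

Let kappa_u i t : kappa (u i t) = w i t. Proof. by []. Qed.

(** A solution gives the root [L] of the eliminant, and a root t gives back the point [zf t].
    Coprimality with the derivative makes the D complex roots distinct; coprimality with the
    coordinate polynomials keeps all points in the torus. *)
Lemma card_torus_quasiequilibria : lead_at idfun u != 0 ->
  coprimep (eliminant_at idfun u)
    ((eliminant_at idfun u)^`() * \prod_(y < n) coord_at idfun u y) ->
  (torus_quasiequilibria u #= `I_D)%card.
Proof.
move=> lead_u cop.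
have leadw : lead_at kappa w = kappa (lead_at idfun u).
  by rewrite /lead_at (map_elim_lead _ _ _ kappa_id kappa_u).
have lead0 : lead_at kappa w != 0 by rewrite leadw fmorph_eq0.
have elimw : eliminant_at kappa w = map_poly kappa (eliminant_at idfun u).
  by rewrite /eliminant_at (map_elim_eliminant _ _ _ kappa_id kappa_u).
have coordw y : coord_at kappa w y = map_poly kappa (coord_at idfun u y).
  by rewrite /coord_at (map_elim_of _ _ _ kappa_id kappa_u).
have [r rE] := closed_field_poly_normal (eliminant_at kappa w).
have lE : lead_coef (eliminant_at kappa w) = lead_at kappa w.
  by rewrite lead_coef_scaleXnB ?size_elim_of.
have rP t : (t \in r) = root (eliminant_at kappa w) t.
  by rewrite rE lE rootZ // root_prod_XsubC.
have size_r : size r = D.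
  have : size (eliminant_at kappa w) = D.+1 by rewrite size_scaleXnB ?size_elim_of.
  by rewrite rE lE size_scale // size_prod_XsubC => -[].
have uniq_r : uniq r.
  have sep : separable_poly (eliminant_at idfun u).
    move: cop; rewrite coprimepMr => /andP[cop _]; rewrite unlock.
    exact: cop.
  rewrite -separable_prod_XsubC; move: sep; rewrite -(separable_map kappa) -elimw rE lE.
  by rewrite (eqp_separable (eqp_scale _ lead0)).
have coord0 t y : t \in r -> (coord_at kappa w y).[t] != 0.
  rewrite rP elimw coordw => rt; apply: contraL cop => yt.
  rewrite -(coprimep_map kappa); apply/negP => /coprimep_root/(_ rt)/negP; apply.
  by rewrite rmorphM rmorph_prod /= hornerM horner_prod (bigD1 y) //= (eqP yt) mul0r mulr0.
pose zf t (i : 'I_n) := (coord_at kappa w i).[t] / lead_at kappa w.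
have zfE t i : lead_at kappa w * zf t i = (coord_at kappa w i).[t].
  by rewrite /zf mulrCA divff // mulr1.
have zf_L t : t \in r -> (map_mpoly kappa L).@[zf t] = t.
  rewrite rP => rt; apply: (mulfI lead0); apply/eqP; rewrite -subr_eq0.
  rewrite -(separator_at_root phi_iota phi_v lead0 rt) hornerD hornerN hornerZ hornerX.
  apply/eqP; congr (_ - _); rewrite !L_eval mulr_sumr horner_sum.
  by apply: eq_bigr => y _; rewrite hornerM hornerC mulrCA zfE.
have zf_quasi t x : t \in r -> (quasi_poly w x).@[zf t] = 0.
  rewrite rP => rt; have := solution_at_root phi_iota phi_v x lead0 rt.
  rewrite -[LHS]/(horner_eval t _)
  (@rmorph_meval _ _ _ _ _ _ (fun y => lead_at kappa w * zf t y)); last first.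
    by move=> y; rewrite zfE.
  rewrite map_mpoly_compE (@map_mpoly_ext _ _ _ idfun); last first.
    by move=> c; rewrite /= /horner_eval hornerC.
  rewrite map_mpoly_id meval_homogenize //; last exact: quasi_supp.
  by move/eqP; rewrite mulf_eq0 expf_eq0 (negPf lead0) andbF => /eqP.
pose sol t : {ffun node d -> R[i]} := [ffun y => zf t (enum_rank y)].
have sol_val t : (fun a : 'I_n => sol t (enum_val a)) =1 zf t.
  by move=> a; rewrite ffunE enum_valK.
have quasi_w x : map_mpoly (real_complex R) (quasi_poly u x) = quasi_poly w x.
  exact: (map_quasi_poly kappa).
have -> : torus_quasiequilibria u = [set` seq_fset tt (map sol r)]%classic.
  apply/seteqP; split=> z /=.
    move=> [zq z0]; rewrite (seq_fsetE tt (map sol r) z).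
    pose z' (a : 'I_n) : R[i] := z (enum_val a).
    have zq' x : (quasi_poly w x).@[z'] = 0 by rewrite -quasi_w; apply: zq.
    set t := (map_mpoly kappa L).@[z'].
    have tr : t \in r.
      rewrite rP; apply/rootP; have [err ->] := eliminant_atP kappa obsw z'.
      by rewrite big1 // => x _; rewrite zq' mulr0.
    apply/mapP; exists t => //; apply/ffunP => y; rewrite ffunE.
    apply: (mulfI lead0); rewrite zfE; have [err errE] := coord_atP kappa obsw z'.
    have := errE (enum_rank y); rewrite /z' enum_rankK => ->.
    by rewrite big1 ?addr0 // => x _; rewrite zq' mulr0.
  rewrite (seq_fsetE tt (map sol r) z) => /mapP[t tr ->]; split.
    by move=> x; rewrite quasi_w (meval_eq _ (sol_val t)) zf_quasi.
  by move=> y; rewrite ffunE mulf_neq0 ?invr_neq0 ?coord0.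
apply/card_eq_fsetP; rewrite size_seq_fset undup_id ?size_map //.
rewrite map_inj_in_uniq // => t1 t2 r1 r2 eq12.
rewrite -(zf_L _ r1) -(zf_L _ r2) -(meval_eq _ (sol_val t1)) eq12.
by rewrite (meval_eq _ (sol_val t2)).
Qed.

End Generic.

(** The special eliminant is the product of the X - [Lc c], which are distinct, and at [Lc c] the
    coordinate polynomials take the nonzero values of the solution [zc c]. *)
Lemma coprimep_special :
  coprimep (eliminant_at idfun u0)
    ((eliminant_at idfun u0)^`() * \prod_(y < n) coord_at idfun u0 y).
Proof.
have lead0 : lead_at idfun u0 != 0 by rewrite lead_at_special oner_neq0.
set Q := eliminant_at idfun u0.
have sizeQ : size Q = D.+1 by rewrite size_scaleXnB ?size_elim_of.
have QE : Q = \prod_(t <- codom Lc) ('X - t%:P).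
  have -> : Q = lead_coef Q *: \prod_(t <- codom Lc) ('X - t%:P).
    apply: all_roots_prod_XsubC; first by rewrite sizeQ size_codom card_ord.
      apply/allP => _ /codomP[c ->]; apply/rootP.
      have [err] := eliminant_atP idfun obs0 (point c); rewrite map_mpoly_id => ->.
      by rewrite big1 // => x _; rewrite point_sol mulr0.
    by rewrite uniq_rootsE map_inj_uniq ?enum_uniq.
  by rewrite lead_coef_scaleXnB ?size_elim_of // -/(lead_at _ _) lead_at_special scale1r.
rewrite coprimepMr; apply/andP; split.
  have : separable_poly Q by rewrite QE separable_prod_XsubC map_inj_uniq ?enum_uniq.
  by rewrite unlock.
elim/big_rec: _ => [|y p _ cop]; first exact: coprimep1.
rewrite coprimepMr cop andbT coprimep_sym QE.
rewrite big_seq; elim/big_rec: _ => [|t q /codomP[c ->] cop']; first exact: coprimep1.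
rewrite coprimepMr cop' andbT coprimep_XsubC; apply/negP => /rootP yc.
have [err errE] := coord_atP idfun obs0 (point c).
have := errE y; rewrite map_mpoly_id yc lead_at_special mul1r add0r.
rewrite big1 => [/eqP|x _]; last by rewrite point_sol mulr0.
by apply/negP; apply: zc_neq0.
Qed.

(* Adding 'X^M * Q to G keeps the common roots with Q and makes the leading
   coefficients of both arguments specialise, so that the resultant does.      *)
Lemma generic_count :
  for_generic_games gamma (fun u : game R d => (torus_quasiequilibria u #= `I_D)%card).
Proof.
(* The universal game, whose payoffs are the coordinate functions on the space of games; evaluating
   at [u] turns it into [u]. *)
pose U : game {mpoly R[#|{: payoff_index d}|]} d := fun i t => 'X_(enum_rank (i, t)).
pose iota : {rmorphism R -> {mpoly R[#|{: payoff_index d}|]}} := @mpolyC _ R.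
pose Q := eliminant_at iota U.
pose G := Q^`() * \prod_(y < n) coord_at iota U y.
(* Where [P] does not vanish, both the leading factor is nonzero and the required coprimality
   holds. *)
pose P := lead_at iota U * resultant Q ('X^(size G) * Q + G).
pose ev (u : game R d) : {rmorphism {mpoly R[#|{: payoff_index d}|]} -> R} :=
  meval (fun c => u (enum_val c).1 (enum_val c).2).
have ev_iota u r : ev u (iota r) = idfun r by rewrite /= mevalC.
have ev_U u i t : ev u (U i t) = u i t by rewrite /= mevalXU enum_rankK.
have evE u p : eval_at_game p u = ev u p by [].
clearbody ev.
have ev_lead u : ev u (lead_at iota U) = lead_at idfun u.
  exact: map_elim_lead (ev_iota u) (ev_U u).
have ev_Q u : map_poly (ev u) Q = eliminant_at idfun u.
  exact: map_elim_eliminant (ev_iota u) (ev_U u).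
have ev_coord u y : map_poly (ev u) (coord_at iota U y) = coord_at idfun u y.
  exact: map_elim_of (ev_iota u) (ev_U u) _.
pose Gu u := (eliminant_at idfun u)^`() * \prod_(y < n) coord_at idfun u y.
have ev_G u : map_poly (ev u) G = Gu u.
  rewrite /G rmorphM rmorph_prod /= -deriv_map ev_Q; congr (_ * _).
  by apply: eq_bigr => y _; rewrite ev_coord.
have ev_P u : lead_at idfun u != 0 ->
    (ev u P != 0) = coprimep (eliminant_at idfun u) (Gu u).
  move=> lead0; have leadU : lead_at iota U != 0.
    by apply: contraNneq lead0 => lead0; rewrite -ev_lead lead0 rmorph0.
  have leadQ : lead_coef Q = lead_at iota U.
    by rewrite lead_coef_scaleXnB ?size_elim_of.
  have Q0 : Q != 0 by rewrite -lead_coef_eq0 leadQ.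
  rewrite rmorphM mulf_eq0 ev_lead (negPf lead0) /=.
  rewrite (@rmorph_resultant _ _ (ev u)) ?lead_coef_shift_add // ?leadQ ?ev_lead //.
  rewrite ev_Q (rmorphD (map_poly (ev u))) (rmorphM (map_poly (ev u))) /= map_polyXn.
  rewrite ev_Q ev_G resultant_eq0 -leqNgt.
  have Qu0 : eliminant_at idfun u != 0.
    by rewrite -size_poly_eq0 size_scaleXnB ?size_elim_of.
  rewrite -(coprimep_addl_mul 'X^(size G)) /coprimep.
  by rewrite eqn_leq [(0 < _)%N]size_poly_gt0 gcdp_eq0 (negPf Qu0) andbT.
exists [set u | obeys gamma u /\ forall p, p \in [:: P] -> eval_at_game p u = 0]%classic.
split; first by exists [:: P].
  split=> [u []//|sub]; have [_ /(_ P)] := sub u0 obs0.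
  rewrite inE eqxx evE => /(_ isT) /eqP; apply/negP.
  by rewrite (ev_P u0) ?coprimep_special // lead_at_special oner_neq0.
move=> u obs notZ.
have evP : ev u P != 0.
  apply/eqP => evP; apply: notZ; split=> // p; rewrite inE => /eqP ->.
  by rewrite evE.
have lead0 : lead_at idfun u != 0.
  by apply: contraNneq evP => lead0; rewrite rmorphM /= ev_lead lead0 mul0r.
by apply: card_torus_quasiequilibria => //; rewrite -ev_P.
Qed.

End Counting.

(** * Spanning a quotient by a product system *)

Section Interpolation.

Variables (F : fieldType) (T : finType) (t : T -> F).
Hypothesis t_inj : injective t.

Lemma Vandermonde_unit m (a : 'rV[F]_m) : injective (a 0) -> Vandermonde m a \in unitmx.
Proof.
move=> a_inj; rewrite unitmxE unitfE det_Vandermonde.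
apply/prodf_neq0 => i _; apply/prodf_neq0 => j ij.
by rewrite subr_eq0 (inj_eq a_inj) -val_eqE gtn_eqF.
Qed.

(** The weights are a column of an inverse Vandermonde matrix on m points of [X], extended by zero.
    They extract the coefficient of T^l from the values of a polynomial of degree less than m. *)
Lemma dual_interpolation (X : {set T}) m (l : 'I_m) : (m <= #|X|)%N ->
  exists kappa : T -> F, forall k, (k < m)%N ->
    \sum_(x in X) kappa x * t x ^+ k = (k == l)%:R.
Proof.
move=> mX; pose e (i : 'I_m) : T := enum_val (widen_ord mX i).
have e_inj : injective e by move=> i j /enum_val_inj /(congr1 val) /= /val_inj.
pose V := Vandermonde m (\row_i t (e i)).
have Vu : V \in unitmx.
  by apply: Vandermonde_unit => i j; rewrite !mxE => /t_inj /e_inj.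
pose c : 'cV[F]_m := invmx V *m delta_mx l 0.
exists (fun x => \sum_i c i 0 * (x == e i)%:R) => k km.
have := congr1 (fun w : 'cV_m => w (Ordinal km) 0) (mulKVmx Vu (delta_mx l 0)).
rewrite -/c !mxE eqxx andbT -val_eqE /= => <-.
under eq_bigr do rewrite mulr_suml.
rewrite exchange_big; apply: eq_bigr => i _ /=.
rewrite (bigD1 (e i)) ?enum_valP //= eqxx mulr1 big1 ?addr0 => [|x /andP[_ /negPf->]].
  by rewrite !mxE mulrC.
by rewrite mulr0 mul0r.
Qed.

Lemma dual_interpolationS (X : {set T}) m (l : 'I_m) : (forall x, t x != 0) ->
  (m <= #|X|)%N ->
  exists kappa : T -> F, forall k, (k < m)%N ->
    \sum_(x in X) kappa x * t x ^+ k.+1 = (k == l)%:R.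
Proof.
move=> t0 mX; have [kappa kP] := dual_interpolation l mX.
exists (fun x => kappa x / t x) => k km; rewrite -(kP k km).
by apply: eq_bigr => x _; rewrite exprS mulrA mulfVK.
Qed.

Lemma interpolation (X : {set T}) m (beta : T -> F) : #|X| = m ->
  exists w : 'I_m -> F, forall x, x \in X -> \sum_l w l * t x ^+ l = beta x.
Proof.
move=> <-; pose e (i : 'I_#|X|) : T := enum_val i.
pose V := Vandermonde #|X| (\row_i t (e i)).
have Vu : V \in unitmx.
  by apply: Vandermonde_unit => i j; rewrite !mxE => /t_inj /enum_val_inj.
pose w := (\row_i beta (e i)) *m invmx V.
exists (w 0) => x xX.
have := congr1 (fun v : 'rV_#|X| => v 0 (enum_rank_in xX x))
  (mulmxKV Vu (\row_i beta (e i))).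
rewrite -/w mxE [in RHS]mxE /e enum_rankK_in // => <-.
by apply: eq_bigr => l _; rewrite [V _ _]mxE [(\row_i t (e i)) _ _]mxE /e enum_rankK_in.
Qed.

Lemma interpolationS (X : {set T}) m (beta : T -> F) : (forall x, t x != 0) ->
  #|X| = m ->
  exists w : 'I_m -> F, forall x, x \in X -> \sum_l w l * t x ^+ l.+1 = beta x.
Proof.
move=> t0 Xm; have [w wP] := interpolation (fun x => beta x / t x) Xm.
exists w => x xX; rewrite -[RHS](mulfVK (t0 x)) -(wP x xX).
by rewrite mulr_suml; apply: eq_bigr => l _; rewrite exprSr mulrA.
Qed.

End Interpolation.

Lemma eq_sum_leq (I : finType) (G H : I -> nat) :
  (forall i, G i <= H i)%N -> (\sum_i G i = \sum_i H i)%N -> G =1 H.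
Proof.
move=> GH /eqP; have le i : xpredT i -> (G i <= H i ?= iff (G i == H i))%N by split.
by rewrite (leqif_sum le).2 => /forall_inP eqGH i; apply/eqP/eqGH.
Qed.

(** Both sides count the nodes. *)
Lemma sum_fibres (N : nat) (d : 'I_N -> nat) (c : node d -> 'I_N) :
  (\sum_j #|[set x | c x == j]| = \sum_j d j)%N.
Proof.
under eq_bigr => j _ do rewrite -sum1dep_card.
have := partition_big c xpredT (fun _ _ => isT) (F := fun=> 1%N) (op := addn) (P := xpredT).
move=> /= <-; under [RHS]eq_bigr => j _ do rewrite -[d j]card_ord -sum1_card.
by rewrite sig_big_dep; apply: eq_bigl => x; rewrite andbT.
Qed.

Section Spanning.

Variables (F : fieldType) (N : nat) (d : 'I_N -> nat).
Local Notation n := #|{: node d}|.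
Variable t : node d -> F.
Hypotheses (t_inj : injective t) (t_neq0 : forall x, t x != 0).

Implicit Types (nb : node d -> {set 'I_N}) (m : 'I_N -> nat) (p : {mpoly F[n]}).

(* With sigma_j(s_{jl}) as the coefficient of T^l, this is the value at r of a
   polynomial of degree at most d_j and constant term 1.                       *)
Definition linear_factor (j : 'I_N) (r : F) : {mpoly F[n]} :=
  1 + \sum_(l < d j) r ^+ l.+1 *: sigma_var F (mknode l).

(** The sets [nb x] are arbitrary rather than given by a graph on the players, since the induction
    changes them one node at a time. *)
Definition product_poly nb x : {mpoly F[n]} := \prod_(j in nb x) linear_factor j (t x).

Definition assignments nb : {set {ffun node d -> 'I_N}} :=
  [set c : {ffun node d -> 'I_N} |
    [forall x, c x \in nb x] && [forall j, #|[set x | c x == j]| == d j]].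

(* The ideal of the product_poly nb x, with control of the block degrees of the
   multipliers: the truncated subtraction is harmless as long as m is positive
   on nb x.                                                                    *)
Definition combination nb m p : Prop :=
  exists a : node d -> {mpoly F[n]},
    (forall x, block_bounded (fun j => m j - (j \in nb x))%N (a x)) /\
    p = \sum_x a x * product_poly nb x.

Lemma linear_factor_bounded j r : block_bounded (fun i => (i == j : nat)) (linear_factor j r).
Proof.
apply: block_boundedD; first exact: block_bounded1.
apply: block_bounded_sum => l _; apply/block_boundedZ/block_bounded_var.
by rewrite /= eqxx.
Qed.

Lemma product_linear_bounded (A : {set 'I_N}) r :
  block_bounded (fun j => (j \in A : nat)) (\prod_(j in A) linear_factor j r).
Proof.
apply: block_boundedW (block_bounded_prod (r := index_enum 'I_N) (P := fun j => j \in A)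
  (fun j _ => @linear_factor_bounded j r)) => j.
under eq_bigr => i _ do rewrite eq_sym.
by rewrite -big_mkcondr big_mkcondl big_pred1_eq; case: (j \in A).
Qed.

Lemma combination0 nb m : combination nb m 0.
Proof.
exists (fun=> 0); split=> [x|]; first exact: block_bounded0.
by rewrite big1 // => x _; rewrite mul0r.
Qed.

Lemma combinationD nb m p q :
  combination nb m p -> combination nb m q -> combination nb m (p + q).
Proof.
move=> [a [ab ->]] [a' [ab' ->]]; exists (fun x => a x + a' x); split=> [x|].
  exact: block_boundedD.
by rewrite -big_split; apply: eq_bigr => x _; rewrite mulrDl.
Qed.

Lemma combinationZ nb m c p : combination nb m p -> combination nb m (c *: p).
Proof.
move=> [a [ab ->]]; exists (fun x => c *: a x); split=> [x|].
  exact: block_boundedZ.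
by rewrite scaler_sumr; apply: eq_bigr => x _; rewrite scalerAl.
Qed.

Lemma combinationB nb m p q :
  combination nb m p -> combination nb m q -> combination nb m (p - q).
Proof. by move=> cp /(@combinationZ _ _ (-1)); rewrite scaleN1r; apply: combinationD. Qed.

Lemma combination_sum nb m (I : Type) (r : seq I) (P : pred I) G :
  (forall i, P i -> combination nb m (G i)) ->
  combination nb m (\sum_(i <- r | P i) G i).
Proof.
move=> cG; elim/big_rec: _ => [|i p Pi cp]; first exact: combination0.
by apply: combinationD => //; apply: cG.
Qed.

Lemma combination_single nb m x a :
  block_bounded (fun j => m j - (j \in nb x))%N a ->
  combination nb m (a * product_poly nb x).
Proof.
move=> ab; exists (fun y => if y == x then a else 0); split=> [y|].
  by case: eqP => [->|_] //; apply: block_bounded0.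
rewrite (bigD1 x) //= eqxx big1 ?addr0 // => y /negPf->.
by rewrite mul0r.
Qed.

Definition spanned nb m : Prop :=
  exists hs : seq {mpoly F[n]}, size hs = #|assignments nb| /\
    forall p, block_bounded m p -> exists b : nat -> F,
      combination nb m (p - \sum_(i < size hs) b i *: hs`_i).

Lemma monomial_reduction (C : {mpoly F[n]} -> Prop) m p :
  C 0 -> (forall p q, C p -> C q -> C (p + q)) -> (forall c p, C p -> C (c *: p)) ->
  (forall e, (forall j, block_degree e j <= m j)%N -> C 'X_[e]) ->
  block_bounded m p -> C p.
Proof.
move=> C0 CD CZ CX bp; rewrite [p]mpolyE big_seq.
by elim/big_ind: _ => [//|//|e ep]; apply/CZ/CX => j; apply: bp.
Qed.

(** An empty product is 1, so the ideal is everything, and no assignment exists. *)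
Lemma spanned_empty nb m x : nb x = finset.set0 -> spanned nb m.
Proof.
move=> nbx; exists [::]; split.
  symmetry; apply/eqP; rewrite cards_eq0; apply/eqP/setP => c; rewrite !inE.
  by apply/negP => /andP[/forallP/(_ x)]; rewrite nbx inE.
move=> p bp; exists (fun=> 0); rewrite big_ord0 subr0.
rewrite -[p]mulr1 -[X in _ * X](_ : product_poly nb x = 1).
  apply: combination_single; rewrite nbx; apply: block_boundedW bp => j.
  by rewrite inE subn0.
by rewrite /product_poly nbx big_set0.
Qed.

Section Singletons.

Variables (nb : node d -> {set 'I_N}) (c : {ffun node d -> 'I_N}).
Hypothesis nbE : forall x, nb x = [set c x].
Local Notation fibre j := [set x | c x == j].

Lemma product_poly_singleton x : product_poly nb x = linear_factor (c x) (t x).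
Proof. by rewrite /product_poly nbE big_set1. Qed.

Lemma combination_linear m j (X : {set node d}) (kappa : node d -> F) a :
  {subset X <= fibre j} -> block_bounded (fun i => m i - (i == j))%N a ->
  combination nb m (a * \sum_(x in X) kappa x *: linear_factor j (t x)).
Proof.
move=> Xj ab; rewrite mulr_sumr; apply: combination_sum => x /Xj; rewrite inE => /eqP cx.
rewrite -scalerAr; apply: combinationZ; rewrite -cx -product_poly_singleton.
apply: combination_single; rewrite nbE; apply: block_boundedW ab => i.
by rewrite inE cx.
Qed.

Lemma sum_linear_factor (X : {set node d}) (kappa : node d -> F) j :
  \sum_(x in X) kappa x *: linear_factor j (t x) =
  (\sum_(x in X) kappa x) *: 1 +
  \sum_(l < d j) (\sum_(x in X) kappa x * t x ^+ l.+1) *: sigma_var F (mknode l).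
Proof.
rewrite scaler_suml -[RHS]/(_ + _).
under [X in _ + X]eq_bigr => l _ do rewrite scaler_suml.
rewrite exchange_big -big_split; apply: eq_bigr => x _ /=.
rewrite /linear_factor scalerDr scaler_sumr; congr (_ + _).
by apply: eq_bigr => l _; rewrite scalerA.
Qed.

(* d_j + 1 of the linear factors of player j span 1 and all variables of j. *)
Lemma overdetermined_combination m j e :
  (d j < #|fibre j|)%N -> (0 < m j)%N -> (forall i, block_degree e i <= m i)%N ->
  combination nb m 'X_[e].
Proof.
move=> dj mj em.
have dual (l : 'I_(d j).+1) := dual_interpolation t_inj l dj.
have Xj : {subset fibre j <= fibre j} by [].
(* With room left in block [j], the constant 1 is expressed by linear factors. Otherwise a variable
   of block [j] is split off and expressed instead, so that the multiplier stays within its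
   bound. *)
have [ej|ej] := ltnP (block_degree e j) (m j).
  have [kappa kP] := dual ord0.
  rewrite -['X_[e]]mulr1 (_ : 1 = \sum_(x in fibre j) kappa x *: linear_factor j (t x)).
    apply: combination_linear => //; apply: block_boundedX => i.
    by case: eqVneq => [->|_]; rewrite ?subn0 // -ltnS subn1 prednK.
  rewrite sum_linear_factor (eq_bigr (fun x => kappa x * t x ^+ 0)) => [|x _].
    rewrite (kP 0%N) // scale1r big1 ?addr0 // => l _.
    by rewrite (kP l.+1) ?ltnS // scale0r.
  by rewrite expr0 mulr1.
have /eqP ejE : block_degree e j == m j by rewrite eqn_leq em.
have [l el] : exists l : 'I_(d j), (0 < var_exponent e (mknode l))%N.
  apply/existsP; apply: contraTT mj.
  rewrite negb_exists => /forallP e0; rewrite -ejE /block_degree big1 // => l _.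
  by apply/eqP; rewrite -leqn0 leqNgt.
have eE : e = (e - U_(enum_rank (mknode l)) + U_(enum_rank (mknode l)))%MM.
  by rewrite submK // lep1mP -lt0n.
set e' := (e - _)%MM in eE.
have e'm i : (block_degree e' i <= m i - (i == j))%N.
  have := em i; rewrite eE block_degreeD block_degree_var /= eq_sym => le_m.
  by rewrite leq_subRL 1?addnC // (leq_trans _ le_m) // leq_addl.
have [kappa kP] := dual (lift ord0 l).
rewrite eE mpolyXD -/(sigma_var F (mknode l)).
rewrite (_ : sigma_var F _ = \sum_(x in fibre j) kappa x *: linear_factor j (t x)).
  by apply: combination_linear => //; apply: block_boundedX.
rewrite sum_linear_factor (eq_bigr (fun x => kappa x * t x ^+ 0)) => [|x _]; last first.
  by rewrite expr0 mulr1.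
rewrite (kP 0%N) // scale0r add0r (bigD1 l) //= (kP l.+1) ?ltnS //= eqxx scale1r.
rewrite big1 ?addr0 // => k /negPf kl.
by rewrite (kP k.+1) ?ltnS //= /bump add1n eqSS val_eqE kl scale0r.
Qed.

(** With at least d_j linear factors for each player j, every variable is congruent to a constant; a
    monomial loses one variable at a time. *)
Lemma determined_combination m e :
  (forall j, d j <= #|fibre j|)%N -> (forall i, block_degree e i <= m i)%N ->
  exists b, combination nb m ('X_[e] - b *: 1).
Proof.
move=> df; have [k le_k] := ubnP (mdeg e); elim: k e le_k => // k IHk e.
rewrite ltnS => le_k em; have [->|e0] := eqVneq e 0%MM.
  by exists 1; rewrite scale1r mpolyX0 subrr; apply: combination0.
have [i ei] : exists i, (0 < e i)%N.
  apply/existsP; apply: contraNT e0; rewrite negb_exists => /forallP e0.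
  by apply/eqP/mnmP => i; rewrite mnm0E; apply/eqP; rewrite -leqn0 leqNgt.
have eE : e = (e - U_(i) + U_(i))%MM by rewrite submK // lep1mP -lt0n.
set e' := (e - _)%MM in eE.
have : i = enum_rank (enum_val i) by rewrite enum_valK.
move: (enum_val i) => [j l] iE.
have e'm a : (block_degree e' a <= m a - (a == j))%N.
  have := em a; rewrite eE {1}iE block_degreeD block_degree_var /= eq_sym => le_m.
  by rewrite leq_subRL 1?addnC // (leq_trans _ le_m) // leq_addl.
have [b' cb'] : exists b, combination nb m ('X_[e'] - b *: 1).
  apply: IHk; last by move=> a; apply: leq_trans (e'm a) (leq_subr _ _).
  by apply: leq_trans le_k; rewrite eE mdegD mdeg1 addn1.
have [kappa kP] := dual_interpolationS t_inj l t_neq0 (df j).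
pose S := \sum_(x in fibre j) kappa x.
have vE : sigma_var F (mknode l) =
    \sum_(x in fibre j) kappa x *: linear_factor j (t x) - S *: 1.
  rewrite sum_linear_factor addrAC subrr add0r (bigD1 l) //= kP // eqxx scale1r.
  by rewrite big1 ?addr0 // => a /negPf al; rewrite kP // val_eqE al scale0r.
exists (- S * b').
rewrite (_ : _ - _ = 'X_[e'] * \sum_(x in fibre j) kappa x *: linear_factor j (t x)
    - S *: ('X_[e'] - b' *: 1)).
  apply: combinationB; last exact: combinationZ.
  by apply: combination_linear => //; apply: block_boundedX.
have -> : 'X_[e] = 'X_[e'] * sigma_var F (mknode l) by rewrite eE mpolyXD iE.
rewrite vE mulrBr -scalerAr mulr1 scalerBr scalerA mulNr scaleNr opprK opprB.
by rewrite [RHS]addrA addrAC.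
Qed.

(** The fibre sizes of [c] and the d_j have the same sum. Either they all agree, [c] is the only
    assignment and 1 spans the quotient; or some fibre is too large, no assignment exists and the
    quotient vanishes. *)
Lemma spanned_singletons m : (forall j, 0 < m j)%N -> spanned nb m.
Proof.
move=> m0.
have assignE c' : (c' \in assignments nb) = (c' == c) && [forall j, #|fibre j| == d j].
  rewrite inE; have [->|neq] /= := eqVneq c' c.
    by rewrite andb_idl // => _; apply/forallP => x; rewrite nbE inE.
  apply/negP => /andP[/forallP cnb _]; case/eqP: neq; apply/ffunP => x.
  by have := cnb x; rewrite nbE inE => /eqP.
have [df|] := boolP [forall j, d j <= #|fibre j|]%N; last first.
  rewrite negb_forall => /existsP[j]; rewrite -ltnNge => fd.
  have [j' dj'] : exists j', (d j' < #|fibre j'|)%N.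
    apply/existsP; apply: contraTT fd; rewrite negb_exists -leqNgt => /forallP fd.
    rewrite leq_eqVlt; apply/orP; left; apply/eqP; symmetry.
    by apply: (eq_sum_leq _ (sum_fibres c)) => i; rewrite leqNgt.
  exists [::]; split.
    symmetry; apply/eqP; rewrite cards_eq0; apply/eqP/setP => c'.
    rewrite assignE inE; apply/negP => /andP[_ /forallP/(_ j')/eqP fj'].
    by rewrite fj' ltnn in dj'.
  move=> p bp; exists (fun=> 0); rewrite big_ord0 subr0.
  apply: (monomial_reduction (combination0 nb m)) bp => [||e em].
  - exact: combinationD.
  - by move=> *; apply: combinationZ.
  - exact: overdetermined_combination dj' (m0 j') em.
have dfE : [forall j, #|fibre j| == d j].
  apply/forallP => j; rewrite eq_sym; apply/eqP.
  by apply: (eq_sum_leq _ (esym (sum_fibres c))) => i; apply: (forallP df).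
exists [:: 1]; split.
  rewrite (_ : assignments nb = finset.set1 c) ?cards1 //.
  by apply/setP => c'; rewrite assignE inE dfE andbT.
move=> p bp.
suff [b cb] : exists b, combination nb m (p - b *: 1).
  by exists (fun=> b); rewrite big_ord1.
apply: (monomial_reduction (C := fun p => exists b, combination nb m (p - b *: 1))) bp.
- by exists 0; rewrite scale0r subrr; apply: combination0.
- move=> p1 p2 [b1 cb1] [b2 cb2]; exists (b1 + b2).
  by rewrite scalerDl opprD addrACA; apply: combinationD.
- by move=> a p1 [b1 cb1]; exists (a * b1); rewrite -scalerA -scalerBr; apply: combinationZ.
- by move=> e em; apply: determined_combination => // j; apply: (forallP df).
Qed.

End Singletons.

Definition set_nb nb (x : node d) (A : {set 'I_N}) : node d -> {set 'I_N} :=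
  fun y => if y == x then A else nb y.

Lemma set_nb_in nb x A : set_nb nb x A x = A.
Proof. by rewrite /set_nb eqxx. Qed.

Lemma set_nb_out nb x A y : y != x -> set_nb nb x A y = nb y.
Proof. by rewrite /set_nb => /negPf->. Qed.

Lemma sum_set_nb (f : {set 'I_N} -> nat) nb x A :
  (\sum_y f (set_nb nb x A y) + f (nb x) = \sum_y f (nb y) + f A)%N.
Proof.
rewrite (bigD1 x) //= [in RHS](bigD1 x) //= set_nb_in addnC addnA addnAC.
by congr (_ + _ + _)%N; apply: eq_bigr => y; apply: (fun h => congr1 f (set_nb_out _ _ h)).
Qed.

(** The assignments are divided according to whether [c x = j]. *)
Lemma card_assignments_split nb x j : j \in nb x ->
  #|assignments nb| =
    (#|assignments (set_nb nb x (finset.set1 j))| + #|assignments (set_nb nb x (nb x :\ j))|)%N.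
Proof.
move=> jx; rewrite -(cardsID [set c : {ffun node d -> 'I_N} | c x == j]).
have mem_set_nb A (c : {ffun node d -> 'I_N}) :
    [forall y, c y \in set_nb nb x A y] =
    (c x \in A) && [forall y, (y != x) ==> (c y \in nb y)].
  apply/forallP/andP => [cA|[cx /forallP cy] y].
    split; first by have := cA x; rewrite set_nb_in.
    by apply/forallP => y; apply/implyP => yx; have := cA y; rewrite set_nb_out.
  have [->|yx] := eqVneq y x; first by rewrite set_nb_in.
  by rewrite set_nb_out //; apply: (implyP (cy y)).
have mem_nb (c : {ffun node d -> 'I_N}) : [forall y, c y \in nb y] =
    (c x \in nb x) && [forall y, (y != x) ==> (c y \in nb y)].
  rewrite -mem_set_nb; apply: eq_forallb => y; rewrite /set_nb.
  by case: eqP => [->|].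
congr (_ + _)%N; apply: eq_card => c; rewrite !inE mem_set_nb mem_nb !inE.
  by have [->|] := eqVneq (c x) j; rewrite ?jx ?andbT ?andbF.
by rewrite !andbA.
Qed.

(* With f' the product of the other factors l_i of f_x = l_j * f' and J the ideal
   of the other equations, S/(l_j, J) --f'--> S/(f_x, J) --> S/(f', J) --> 0.   *)
Lemma spanned_split nb m x j : j \in nb x ->
  (forall i, \sum_y (i \in nb y) < m i)%N ->
  spanned (set_nb nb x (nb x :\ j)) m ->
  spanned (set_nb nb x (finset.set1 j)) (fun i => m i - (i \in nb x :\ j))%N ->
  spanned nb m.
Proof.
move=> jx ltm [hB [sB spanB]] [hA [sA spanA]].
set A := nb x :\ j in spanB spanA.
pose f := \prod_(i in A) linear_factor i (t x).
exists (hB ++ [seq h * f | h <- hA]).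
split; first by rewrite size_cat size_map sA sB addnC -card_assignments_split.
move=> p bp; have [b [a [ab aE]]] := spanB p bp.
have ax : block_bounded (fun i => m i - (i \in A))%N (a x).
  by have := ab x; rewrite set_nb_in.
(* The multiplier of f' in the reduction of [p] is reduced in turn, now modulo the linear factor of
   [j] and the other equations. *)
have [b' [a' [ab' aE']]] := spanA _ ax.
exists (fun i => if (i < size hB)%N then b i else b' (i - size hB)%N).
(* The hypothesis counts [x] and [y] separately, so a multiplier of [product_poly nb y] can absorb
   the factor [f]. *)
have ltm2 y i : y != x -> ((i \in nb y) + (i \in A) < m i)%N.
  move=> yx; apply: leq_ltn_trans (ltm i).
  rewrite (bigD1 y) //= (bigD1 x) 1?eq_sym //= leq_add //.
  by rewrite (leq_trans _ (leq_addr _ _)) // /A !inE; case: (i == j).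
have pE : p - \sum_(i < size (hB ++ [seq h * f | h <- hA]))
      (if (i < size hB)%N then b i else b' (i - size hB)%N) *:
        (hB ++ [seq h * f | h <- hA])`_i =
    (\sum_y a' y * product_poly (set_nb nb x (finset.set1 j)) y) * f +
    \sum_(y | y != x) a y * product_poly nb y.
  have -> : \sum_(i < size (hB ++ [seq h * f | h <- hA]))
      (if (i < size hB)%N then b i else b' (i - size hB)%N) *:
        (hB ++ [seq h * f | h <- hA])`_i =
    \sum_(i < size hB) b i *: hB`_i + (\sum_(i < size hA) b' i *: hA`_i) * f.
    rewrite size_cat size_map big_split_ord; congr (_ + _).
      by apply: eq_bigr => i _ /=; rewrite ltn_ord nth_cat ltn_ord.
    rewrite mulr_suml; apply: eq_bigr => i _ /=.
    rewrite ltnNge leq_addr nth_cat ltnNge leq_addr /= addKn.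
    by rewrite (nth_map 0) // scalerAl.
  rewrite opprD addrA aE (bigD1 x) //= addrAC -aE' mulrBl.
  congr (_ - _ + _).
    by rewrite /product_poly set_nb_in.
  by apply: eq_bigr => y yx; rewrite /product_poly set_nb_out.
rewrite pE; apply: combinationD; last first.
  apply: combination_sum => y yx; apply: combination_single.
  by have := ab y; rewrite set_nb_out.
rewrite (bigD1 x) //= mulrDl; apply: combinationD.
  have -> : a' x * product_poly (set_nb nb x (finset.set1 j)) x * f = a' x * product_poly nb x.
    by rewrite /product_poly set_nb_in big_set1 -mulrA (big_setD1 j jx).
  apply: combination_single; apply: block_boundedW (ab' x) => i.
  rewrite set_nb_in /A !inE -subnDA leq_sub2l //.
  by have [->|_] := eqVneq i j; rewrite ?jx ?addn0.
rewrite mulr_suml; apply: combination_sum => y yx.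
have -> : a' y * product_poly (set_nb nb x (finset.set1 j)) y * f =
    a' y * f * product_poly nb y.
  by rewrite /product_poly set_nb_out // mulrAC.
apply: combination_single.
apply: block_boundedW (block_boundedM (ab' y) (@product_linear_bounded A (t x))) => i.
rewrite set_nb_out //; have := ltm2 y i yx.
by case: (i \in A); case: (i \in nb y) => /=; lia.
Qed.

(** Induction on the total size of the sets: one with at least two elements is split, until some set
    is empty or all are singletons. *)
Lemma spanned_all nb m : (forall i, \sum_y (i \in nb y) < m i)%N -> spanned nb m.
Proof.
have [k le_k] := ubnP (\sum_y #|nb y|)%N; elim: k nb m le_k => // k IHk nb m.
rewrite ltnS => le_k ltm.
have [/existsP[x /eqP nbx]|] := boolP [exists x, nb x == finset.set0].
  exact: spanned_empty nbx.
rewrite negb_exists => /forallP nb0.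
have [/existsP[x nbx]|] := boolP [exists x, 1 < #|nb x|]%N; last first.
  rewrite negb_exists => /forallP nb1.
  have nbE x : exists j, nb x = finset.set1 j.
    by apply/cards1P; rewrite eqn_leq card_gt0 nb0 andbT leqNgt.
  have [c cE] := fin_all_exists nbE.
  apply: (@spanned_singletons nb [ffun x => c x]); first by move=> x; rewrite ffunE.
  by move=> j; apply: leq_ltn_trans (ltm j).
have [j jx] : exists j, j \in nb x by apply/set0Pn; apply: nb0.
have cardD := cardsD1 j (nb x); rewrite jx in cardD.
apply: (spanned_split jx ltm); apply: IHk.
- have := sum_set_nb (fun A => #|A|) nb x (nb x :\ j); lia.
- move=> i; have := sum_set_nb (fun A => (i \in A : nat)) nb x (nb x :\ j).
  have := ltm i; rewrite !inE; case: (i == j); case: (i \in nb x) => /=; lia.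
- have := sum_set_nb (fun A => #|A|) nb x (finset.set1 j); rewrite cards1; lia.
- move=> i; have := sum_set_nb (fun A => (i \in A : nat)) nb x (finset.set1 j).
  have := ltm i; rewrite !inE; have [->|_] := eqVneq i j; rewrite ?jx /=; first lia.
  by case: (i \in nb x) => /=; lia.
Qed.

(** Let [W] express the powers of [L] by the D spanning elements. Evaluated at the D points, [W]
    times the matrix of values is an invertible Vandermonde matrix; so [W] is invertible and the
    powers span as well. *)
Lemma spanned_powers nb m D (L : {mpoly F[n]}) (z : 'I_D -> 'I_n -> F) :
  (forall i, \sum_y (i \in nb y) < m i)%N -> #|assignments nb| = D ->
  (forall k, (k < D)%N -> block_bounded m (L ^+ k)) ->
  injective (fun c => L.@[z c]) -> (forall c x, (product_poly nb x).@[z c] = 0) ->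
  forall p, block_bounded m p -> exists b : 'I_D -> F,
    combination nb m (p - \sum_k b k *: L ^+ k).
Proof.
move=> ltm cardD Lb L_inj zP p bp.
have [hs [sD span]] := spanned_all ltm; rewrite cardD in sD.
have /fin_all_exists[M MP] (k : 'I_D) : exists b : 'rV[F]_D,
    combination nb m (L ^+ k - \sum_i b 0 i *: hs`_i).
  have [b bP] := span _ (Lb k (ltn_ord k)); exists (\row_i b i).
  by rewrite sD in bP; under eq_bigr => i _ do rewrite mxE.
have comb0 q c : combination nb m q -> q.@[z c] = 0.
  move=> [a [_ ->]]; rewrite (raddf_sum (meval (z c))) big1 // => x _.
  by rewrite /= mevalM zP mulr0.
pose W := \matrix_(k, i) M k 0 i.
have WH : W *m (\matrix_(i, c) (hs`_i).@[z c]) = Vandermonde D (\row_c L.@[z c]).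
  apply/matrixP => k c; rewrite !mxE.
  have := comb0 _ c (MP k); rewrite mevalB => /subr0_eq; rewrite rmorphXn /= => ->.
  rewrite (raddf_sum (meval (z c))); apply: eq_bigr => i _.
  by rewrite /= mevalZ !mxE.
have Wu : W \in unitmx.
  have : Vandermonde D (\row_c L.@[z c]) \in unitmx.
    by apply: Vandermonde_unit => i j; rewrite !mxE => /L_inj.
  by rewrite -WH unitmx_mul => /andP[].
have [b bP] := span p bp; rewrite sD in bP.
pose b' := (\row_i b i) *m invmx W; exists (b' 0).
have -> : p - \sum_k b' 0 k *: L ^+ k = p - \sum_(i < D) b i *: hs`_i -
    \sum_k b' 0 k *: (L ^+ k - \sum_i M k 0 i *: hs`_i).
  rewrite -addrA -opprD; congr (_ - _).
  under [X in _ + X]eq_bigr => k _ do rewrite scalerBr scaler_sumr.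
  rewrite sumrB [X in _ - X]exchange_big /= [RHS]addrC -addrA.
  rewrite [X in _ = _ + X](_ : _ = 0) ?addr0 //.
  apply/eqP; rewrite addrC subr_eq0; apply/eqP; apply: eq_bigr => i _.
  under eq_bigr => k _ do rewrite scalerA.
  rewrite -scaler_suml; congr (_ *: _).
  have := congr1 (fun v : 'rV_D => v 0 i) (mulmxKV Wu (\row_i b i)).
  rewrite -/b' mxE [in RHS]mxE => <-; apply: eq_bigr => k _.
  by rewrite [W _ _]mxE.
apply: combinationB => //; apply: combination_sum => k _; exact/combinationZ/MP.
Qed.

End Spanning.

(** * The product system *)

(** With weights k^0, k^1, ... the linear form at a point is the value at k of the polynomial whose
    coefficients are the coordinates. Some integer k avoids the roots of all differences of these
    polynomials. *)
Lemma separating_weights (R : numDomainType) (T : finType) (D : nat) (z : 'I_D -> T -> R) :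
  (forall c c', z c =1 z c' -> c = c') ->
  exists lambda : T -> R, injective (fun c => \sum_y lambda y * z c y).
Proof.
move=> z_inj; pose p c : {poly R} := \sum_(i < #|T|) z c (enum_val i) *: 'X^i.
have pE c i : (p c)`_(enum_rank i) = z c i.
  rewrite coef_sum (bigD1 (enum_rank i)) //= enum_rankK coefZ coefXn eqxx mulr1.
  rewrite big1 ?addr0 // => j /negPf ji.
  by rewrite coefZ coefXn eq_sym val_eqE ji mulr0.
pose Q := \prod_(cc : 'I_D * 'I_D | cc.1 != cc.2) (p cc.1 - p cc.2).
have Q0 : Q != 0.
  apply/prodf_neq0 => -[c c'] /= neq; rewrite subr_eq0; apply: contraNneq neq => eq_p.
  by apply/eqP/z_inj => y; rewrite -!pE eq_p.
have [k Qk] : exists k : 'I_(size Q), ~~ root Q k%:R.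
  apply/existsP; rewrite -negb_forall; apply: contraNN Q0 => /forallP Qr.
  apply/eqP/(@roots_geq_poly_eq0 _ _ [seq (nat_of_ord k)%:R | k : 'I_(size Q)]).
  - by apply/allP => _ /mapP[k _ ->].
  - rewrite map_inj_uniq ?enum_uniq // => i j /eqP.
    by rewrite eqr_nat => /eqP/val_inj.
  - by rewrite size_map -cardE card_ord.
exists (fun y => k%:R ^+ enum_rank y) => c c' eq_c; apply/eqP; apply: contraNT Qk => neq.
have pk a : \sum_y k%:R ^+ enum_rank y * z a y = (p a).[k%:R].
  rewrite horner_sum (reindex (@enum_val T T)) /=; last exact/onW_bij/enum_val_bij.
  by apply: eq_bigr => i _; rewrite enum_valK hornerZ hornerXn mulrC.
rewrite !pk in eq_c; rewrite /root horner_prod; apply/prodf_eq0; exists (c, c') => //=.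
by rewrite hornerD hornerN eq_c subrr.
Qed.

Lemma prod_linear_size (R : comNzRingType) (s : seq R) :
  (size (\prod_(a <- s) (1 - a *: 'X))%R <= (size s).+1)%N.
Proof.
elim: s => [|a s IHs]; first by rewrite big_nil size_poly1.
rewrite big_cons mulrBl mul1r (leq_trans (size_polyD _ _)) // geq_max size_polyN.
rewrite (leq_trans IHs) //= -scalerAl (leq_trans (size_scale_leq _ _)) //.
by rewrite mulrC (leq_trans (size_polyMleq _ _)) // size_polyX addn2.
Qed.

Lemma prod_linear_coef0 (R : comNzRingType) (s : seq R) :
  (\prod_(a <- s) (1 - a *: 'X))`_0 = 1.
Proof.
rewrite -horner_coef0 horner_prod big1_seq // => a _.
by rewrite !hornerE subr0.
Qed.

(** Up to sign the coefficients are elementary symmetric functions of positive numbers. This puts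
    the special solutions in the torus. *)
Lemma prod_linear_coef_sign (R : realDomainType) (s : seq R) k :
  all (fun a => 0 < a) s -> (k <= size s)%N ->
  0 < (-1) ^+ k * (\prod_(a <- s) (1 - a *: 'X))`_k.
Proof.
elim: s k => [|a s IHs] k /=.
  by move=> _; rewrite leqn0 => /eqP ->; rewrite big_nil coef1 expr0 mulr1 ltr01.
move=> /andP[a0 s0] ks; rewrite big_cons mulrBl mul1r coefB -scalerAl coefZ coefXM.
case: k ks => [|k] ks /=; first by rewrite mulr0 subr0 IHs.
rewrite mulrBr [in X in _ - X]exprS mulN1r mulNr opprK [in X in _ + X]mulrCA.
have pos : 0 < a * ((-1) ^+ k * (\prod_(a <- s) (1 - a *: 'X))`_k).
  by rewrite mulr_gt0 ?IHs.
have [ks'|ks'] := ltnP k (size s).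
  by rewrite addr_gt0 // IHs.
by rewrite [_`_k.+1]nth_default ?mulr0 ?add0r // (leq_trans (prod_linear_size s)).
Qed.

Section SpecialSystem.

Variables (R : realFieldType) (N : nat) (d : 'I_N -> nat) (gamma : rel 'I_N).
Hypothesis gamma_irr : irreflexive gamma.
Local Notation n := #|{: node d}|.

(** Ranks start at 0; adding 1 makes the parameters positive as well as distinct. *)
Definition node_param (x : node d) : R := (enum_rank x).+1%:R.
Local Notation t := node_param.

Lemma node_param_gt0 x : 0 < t x.
Proof. by rewrite ltr0n. Qed.

Lemma node_param_neq0 x : t x != 0.
Proof. by rewrite lt0r_neq0 ?node_param_gt0. Qed.

Lemma node_param_inj : injective t.
Proof. by move=> x y /eqP; rewrite eqr_nat => /eqP [] /val_inj/enum_rank_inj. Qed.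

(** The summand 1, present for every strategy, contributes the total of the sigma_j, which is 1; the
    powers of [t x] contribute the rest of the linear factor. *)
Definition special_weight (x : node d) j (a : 'I_(d j).+1) : R :=
  if unlift ord0 a is Some l then 1 + t x ^+ l.+1 else 1.

(* The weights are chosen so that f_x becomes the product of the linear factors of
   the neighbours of x at t x.                                                 *)
Definition special_game : game R d := fun i s =>
  if unlift ord0 (s i) is Some k
  then \prod_(j | gamma i j) special_weight (mknode k) (s j) else 0.

Definition neighbours (x : node d) : {set 'I_N} := [set j | gamma (tag x) j].

Lemma obeys_special_game : obeys gamma special_game.
Proof.
move=> i s s' si sj; rewrite /special_game si; case: unlift => // k.
apply: eq_bigr => j gij; have [->|neq] := eqVneq j i; first by rewrite si.
by rewrite sj.
Qed.

Lemma sum_special_weight x j :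
  \sum_(a < (d j).+1) (special_weight x a)%:MP * sigma R a = linear_factor d j (t x).
Proof.
have <- : \sum_(a < (d j).+1) sigma R a +
    \sum_(l < d j) t x ^+ l.+1 *: sigma_var R (mknode l) = linear_factor d j (t x).
  by rewrite sum_sigma.
rewrite big_ord_recl [in RHS]big_ord_recl /special_weight unlift_none mpolyC1 mul1r.
rewrite -addrA -big_split; congr (_ + _); apply: eq_bigr => l _ /=.
by rewrite liftK /sigma liftK mpolyCD mpolyC1 mulrDl mul1r mul_mpolyC.
Qed.

Lemma quasi_special_game x : quasi_poly special_game x = product_poly t neighbours x.
Proof.
rewrite /quasi_poly [X in _ - X](_ : _ = 0) ?subr0; last first.
  rewrite /payoff_poly big1 // => s /eqP si.
  by rewrite /special_game si unlift_none mpolyC0 mul0r.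
(* Players that are not neighbours get the constant weight 1, so that the sum distributes over all
   players other than [tag x]; their factors are then 1. *)
rewrite /payoff_poly; pose W j (a : 'I_(d j).+1) : {mpoly R[n]} :=
  (if gamma (tag x) j then special_weight x a else 1)%:MP * sigma R a.
rewrite (eq_bigr (fun s : strategy_profile d => \prod_(j | j != tag x) W j (s j))); last first.
  move=> s /eqP si; rewrite /special_game si liftK mknodeE big_split /=; congr (_ * _).
  rewrite -rmorph_prod; congr mpolyC; rewrite big_mkcond [RHS]big_mkcond.
  apply: eq_bigr => j _; case: eqVneq => [->|_] //=.
  by rewrite gamma_irr.
rewrite (sum_prod_profile (lift ord0 (tagged x)) W) big_mkcond.
rewrite /product_poly [RHS]big_mkcond; apply: eq_bigr => j _.
rewrite inE /W; case: eqVneq => [->|_] /=; first by rewrite gamma_irr.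
case: ifP => _; first exact: sum_special_weight.
by under eq_bigr => a _ do rewrite mpolyC1 mul1r; rewrite sum_sigma.
Qed.

Section Point.

Variable c : {ffun node d -> 'I_N}.
Hypothesis c_assign : c \in assignments neighbours.
Local Notation fibre j := [set x | c x == j].

(* The solution attached to c: the polynomial of player j vanishes exactly at the
   parameters of the nodes assigned to j.                                      *)
Definition fibre_poly j : {poly R} := \prod_(x in fibre j) (1 - (t x)^-1 *: 'X).

Definition special_point (y : node d) : R := (fibre_poly (tag y))`_(tagged y).+1.

Lemma card_fibre j : #|fibre j| = d j.
Proof. by move: c_assign; rewrite inE => /andP[_ /forallP/(_ j)/eqP]. Qed.

Lemma assignment_neighbour x : c x \in neighbours x.
Proof. by move: c_assign; rewrite inE => /andP[/forallP]. Qed.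

Lemma fibre_poly_seq j :
  fibre_poly j = \prod_(a <- [seq (t x)^-1 | x in fibre j]) (1 - a *: 'X).
Proof. by rewrite big_map big_enum. Qed.

Lemma size_fibre_seq j : size [seq (t x)^-1 | x in fibre j] = d j.
Proof. by rewrite size_map -cardE card_fibre. Qed.

Lemma special_point_neq0 y : special_point y != 0.
Proof.
rewrite /special_point fibre_poly_seq.
have := @prod_linear_coef_sign R [seq (t x)^-1 | x in fibre (tag y)] (tagged y).+1.
rewrite size_fibre_seq => pos; apply/eqP => p0; move: pos.
rewrite p0 mulr0 ltxx => pos; suff: false by []; apply: pos; last exact: ltn_ord.
by apply/allP => _ /mapP[x _ ->]; rewrite invr_gt0 node_param_gt0.
Qed.

Lemma eval_linear_factor j r :
  (linear_factor d j r).@[fun i => special_point (enum_val i)] = (fibre_poly j).[r].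
Proof.
rewrite (@horner_coef_wide _ (d j).+1); last first.
  by rewrite fibre_poly_seq -[in X in (_ <= X)%N](size_fibre_seq j) prod_linear_size.
rewrite big_ord_recl fibre_poly_seq prod_linear_coef0 expr0 mulr1 -fibre_poly_seq.
rewrite mevalD meval1 (raddf_sum (meval _)); congr (_ + _); apply: eq_bigr => l _.
by rewrite /= mevalZ mevalXU enum_rankK mulrC /bump add1n.
Qed.

Lemma root_fibre_poly j x : ((fibre_poly j).[t x] == 0) = (c x == j).
Proof.
rewrite horner_prod; apply/prodf_eq0/eqP => [[y]|cx].
  rewrite inE => /eqP <-; rewrite !hornerE subr_eq0 eq_sym => /eqP xy.
  congr (c _); apply/node_param_inj; apply: (mulfI (invr_neq0 (node_param_neq0 y))).
  by rewrite xy mulVf ?node_param_neq0.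
exists x; first by rewrite inE cx.
by rewrite !hornerE mulVf ?node_param_neq0 // subrr.
Qed.

Lemma special_point_solution x :
  (product_poly t neighbours x).@[fun i => special_point (enum_val i)] = 0.
Proof.
rewrite /product_poly rmorph_prod /=; apply/eqP/prodf_eq0; exists (c x).
  exact: assignment_neighbour.
by rewrite eval_linear_factor root_fibre_poly.
Qed.

End Point.

(** The assignment is recovered from the point: [c x] is the player whose polynomial vanishes at the
    parameter of [x]. *)
Lemma special_point_inj c c' : c \in assignments neighbours ->
  c' \in assignments neighbours -> special_point c =1 special_point c' -> c = c'.
Proof.
move=> ca ca' eq_p; apply/ffunP => x; apply/eqP; rewrite eq_sym -root_fibre_poly.
rewrite -(eval_linear_factor ca') -(meval_eq _ (fun i => eq_p (enum_val i))).
by rewrite eval_linear_factor // root_fibre_poly.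
Qed.

End SpecialSystem.

(** * Lifting solutions *)

Lemma quasi_poly_affine (A : comNzRingType) (N : nat) (d : 'I_N -> nat) (r : A)
    (u v : game A d) x :
  quasi_poly (fun i s => u i s + v i s * r) x =
  quasi_poly u x + r *: quasi_poly v x.
Proof.
have payoffE i (a : 'I_(d i).+1) : payoff_poly (fun i s => u i s + v i s * r) a =
    payoff_poly u a + r *: payoff_poly v a.
  rewrite /payoff_poly scaler_sumr -big_split; apply: eq_bigr => s _ /=.
  by rewrite mpolyCD mulrDl; congr (_ + _); rewrite [v i s * r]mulrC mpolyCM -mulrA mul_mpolyC.
by rewrite /quasi_poly !payoffE opprD addrACA scalerBr.
Qed.

Lemma quasi_line_game (R : comNzRingType) (N : nat) (d : 'I_N -> nat)
    (u0 u : game R d) x :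
  exists r, quasi_poly (line_game u0 u) x = map_mpoly polyC (quasi_poly u0 x) + 'X *: r.
Proof.
exists (quasi_poly (fun i s => (u i s - u0 i s)%:P) x).
by rewrite map_quasi_poly -quasi_poly_affine.
Qed.

Lemma dvdX_horner0 (F : fieldType) (p : {poly F}) : ('X %| p) = (p.[0] == 0).
Proof. by rewrite -['X]subr0 -polyC0 dvdp_XsubCl. Qed.

Section Lifting.

Variables (R : realFieldType) (N : nat) (d : 'I_N -> nat) (gamma : rel 'I_N).
Hypothesis gamma_irr : irreflexive gamma.
Local Notation n := #|{: node d}|.
Local Notation t := (@node_param R N d).
Local Notation nb := (neighbours (d := d) gamma).
Local Notation u0 := (special_game R gamma (d := d)).

Variables (c : {ffun node d -> 'I_N}) (u : game R d).
Hypothesis c_assign : c \in assignments nb.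

Let special_value (x : node d) (z : 'I_n -> {poly R}) j : {poly R} :=
  (map_mpoly polyC (linear_factor d j (t x))).@[z].

Let special_valueE x z j : special_value x z j =
  1 + \sum_(l < d j) (t x ^+ l.+1)%:P * z (enum_rank (mknode l)).
Proof.
rewrite /special_value /linear_factor rmorphD rmorph1 mevalD meval1.
rewrite (raddf_sum (map_mpoly polyC)) (raddf_sum (meval z)); congr (_ + _).
by apply: eq_bigr => l _; rewrite /= map_mpolyZ map_mpolyX mevalZ mevalXU.
Qed.

Let quasi_special_value x z :
  (map_mpoly polyC (quasi_poly u0 x)).@[z] = \prod_(j in nb x) special_value x z j.
Proof. by rewrite quasi_special_game // /product_poly !rmorph_prod. Qed.

Let special_value0 (z : 'I_n -> {poly R}) :
  (forall i, (z i).[0] = special_point R c (enum_val i)) ->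
  forall x j, (special_value x z j).[0] = (fibre_poly R c j).[t x].
Proof.
move=> z0 x j; rewrite -(eval_linear_factor c_assign) -[LHS]/(horner_eval 0 _).
rewrite (@rmorph_meval _ _ _ _ _ _ (fun i => special_point R c (enum_val i))); last first.
  by move=> i; rewrite /= /horner_eval z0.
rewrite map_mpoly_compE; congr _.@[_]; apply/mpolyP => e.
by rewrite mcoeff_map_mpoly /= /horner_eval hornerC.
Qed.

(** At the special solution only the factor of player [c x] in f_x vanishes, so to first order f_x
    depends only on the variables of that player. The correction is therefore found for each player
    separately, by interpolation at the d_j nodes of the fibre. *)
Lemma newton_step k (z : 'I_n -> {poly R}) : (0 < k)%N ->
  (forall i, (z i).[0] = special_point R c (enum_val i)) ->
  (forall x, 'X^k %| (quasi_poly (line_game u0 u) x).@[z]) ->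
  exists w : node d -> R, forall x : node d,
    'X^(k.+1) %| (quasi_poly (line_game u0 u) x).@[fun i => z i + 'X^k * (w (enum_val i))%:P].
Proof.
move=> k0 z0 zk.
have value0 := special_value0 z0.
pose A x := \prod_(j in nb x | j != c x) special_value x z j.
have A0 x : (A x).[0] != 0.
  rewrite horner_prod; apply/prodf_neq0 => j /andP[_ jc].
  by rewrite value0 root_fibre_poly // eq_sym.
pose h x := (quasi_poly (line_game u0 u) x).@[z] %/ 'X^k.
have hE x : (quasi_poly (line_game u0 u) x).@[z] = 'X^k * h x.
  by rewrite mulrC divpK.
have fibreP j := interpolationS (@node_param_inj R N d)
  (fun x => - (h x).[0] / (A x).[0]) (@node_param_neq0 R N d) (card_fibre c_assign j).
have [w wP] : exists w : forall j, 'I_(d j) -> R, forall j x, c x = j ->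
    \sum_l w j l * t x ^+ l.+1 = - (h x).[0] / (A x).[0].
  have [w wP] := fin_all_exists fibreP; exists w => j x cx.
  by apply: wP; rewrite inE cx.
exists (fun y => w (tag y) (tagged y)) => x.
set z' : 'I_n -> {poly R} := fun i => z i + _.
have value' j : special_value x z' j =
    special_value x z j + 'X^k * (\sum_l w j l * t x ^+ l.+1)%:P.
  rewrite !special_valueE -addrA; congr (_ + _).
  rewrite rmorph_sum mulr_sumr -big_split; apply: eq_bigr => l _ /=.
  by rewrite /z' enum_rankK /= mulrDr rmorphM /= mulrCA [_%:P * _%:P]mulrC.
have zz' i : 'X^k %| z' i - z i by rewrite /z' addrAC subrr add0r dvdp_mulr.
have [r rE] := quasi_line_game u0 u x.
have -> : (quasi_poly (line_game u0 u) x).@[z'] =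
    'X^k * h x + 'X * (r.@[z'] - r.@[z]) +
    (\prod_(j in nb x) special_value x z' j - \prod_(j in nb x) special_value x z j).
  rewrite -hE rE !mevalD !mevalZ !quasi_special_value mulrBr.
  by ring.
have cx : c x \in nb x := assignment_neighbour c_assign x.
rewrite !(bigD1 (c x) cx) /=.
set A' := \prod_(j in nb x | j != c x) special_value x z' j.
rewrite -/(A x) value' (wP _ x erefl); set beta := - _ / _.
have AA' : 'X^k %| A' - A x.
  by apply: prod_congr => j _; rewrite value' addrAC subrr add0r dvdp_mulr.
have vc : 'X %| special_value x z (c x).
  by rewrite dvdX_horner0 value0 root_fibre_poly // eqxx.
(* The choice of [beta] makes the first term divisible by X^(k+1); each other term has a factor
   divisible by X^k and another divisible by X. *)
have -> : 'X^k * h x + 'X * (r.@[z'] - r.@[z]) +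
    ((special_value x z (c x) + 'X^k * beta%:P) * A' - special_value x z (c x) * A x) =
    'X^k * (h x + beta%:P * A x) + 'X * (r.@[z'] - r.@[z]) +
    special_value x z (c x) * (A' - A x) + 'X^k * (beta%:P * (A' - A x)).
  by ring.
have rr : 'X^k %| r.@[z'] - r.@[z] by apply: meval_congr.
have X_AA' : 'X %| A' - A x.
  by apply: dvdp_trans AA'; rewrite -(prednK k0) exprS dvdp_mulr.
rewrite !dvdp_add //.
- rewrite exprSr dvdp_mul // dvdX_horner0 hornerD hornerM hornerC /beta.
  by rewrite mulfVK // subrr.
- by rewrite exprS dvdp_mul.
- by rewrite exprS dvdp_mul.
- by rewrite exprSr dvdp_mul // dvdp_mull.
Qed.

Lemma lift_special_point m : exists z : 'I_n -> {poly R},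
  (forall i, (z i).[0] = special_point R c (enum_val i)) /\
  forall x, 'X^m %| (quasi_poly (line_game u0 u) x).@[z].
Proof.
(* The induction starts at order 1, because a Newton step needs a positive order. *)
suff: exists z : 'I_n -> {poly R},
  (forall i, (z i).[0] = special_point R c (enum_val i)) /\
  forall x, 'X^(m.+1) %| (quasi_poly (line_game u0 u) x).@[z].
  move=> [z [z0 zm]]; exists z; split=> // x.
  by apply: dvdp_trans (zm x); rewrite exprS dvdp_mull.
elim: m => [|m [z [z0 zm]]].
  exists (fun i => (special_point R c (enum_val i))%:P); split=> [i|x].
    by rewrite hornerC.
  rewrite expr1; have [r ->] := quasi_line_game u0 u x.
  rewrite mevalD mevalZ dvdp_add ?dvdp_mulr // quasi_special_value.
  have cx : c x \in nb x := assignment_neighbour c_assign x.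
  rewrite (bigD1 (c x) cx) dvdp_mulr // dvdX_horner0 special_value0 ?root_fibre_poly //.
  by move=> i; rewrite hornerC.
have [w wP] := newton_step (ltn0Sn m) z0 zm.
exists (fun i => z i + 'X^(m.+1) * (w (enum_val i))%:P); split=> // i.
by rewrite !hornerE /= z0 expr0n mul0r addr0.
Qed.

End Lifting.

(** * The permanent *)

Lemma sum_perm_enum (R : comNzRingType) (T : finType) (A : T -> T -> R) :
  \sum_(s : 'S_#|T|) \prod_(a < #|T|) A (enum_val a) (enum_val (s a)) =
  \sum_(s : {perm T}) \prod_x A x (s x).
Proof.
pose to_fun (s : 'S_#|T|) (x : T) : T := enum_val (s (enum_rank x)).
have to_inj s : injective (to_fun s).
  by move=> x y /enum_val_inj /perm_inj /enum_rank_inj.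
pose of_fun (s : {perm T}) (a : 'I_#|T|) : 'I_#|T| := enum_rank (s (enum_val a)).
have of_inj s : injective (of_fun s).
  by move=> x y /enum_rank_inj /perm_inj /enum_val_inj.
rewrite (reindex (fun s => perm (@of_inj s))) /=; last first.
  exists (fun s => perm (@to_inj s)) => s _; apply/permP => x; rewrite !permE.
    by rewrite /to_fun permE /of_fun !enum_rankK.
  by rewrite /of_fun permE /to_fun !enum_valK.
apply: eq_bigr => s _; rewrite [RHS](reindex (@enum_val T T)) /=; last exact/onW_bij/enum_val_bij.
by apply: eq_bigr => a _; rewrite permE /of_fun enum_rankK.
Qed.

Section Permanent.

Variables (N : nat) (d : 'I_N -> nat).

Lemma mknode_inj j : injective (@mknode N d j).
Proof. by move=> k l /eqP; rewrite eq_Tagged => /eqP. Qed.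

Definition target (s : {perm node d}) : {ffun node d -> 'I_N} := [ffun x => tag (s x)].

Lemma target_fibre s j : #|[set x | target s x == j]| = d j.
Proof.
rewrite -[RHS]card_ord -cardsT -(card_imset _ (@mknode_inj j)).
rewrite -(card_imset _ (@perm_inj _ s)); congr #|pred_of_set _|.
apply/setP => y; apply/imsetP/imsetP => [[x]|[l _ ->]].
  rewrite inE ffunE => /eqP <- ->; exists (tagged (s x)) => //.
  by rewrite mknodeE.
by exists ((s^-1)%g (mknode l)); rewrite ?inE ?ffunE permKV.
Qed.

Definition block_perm_fun (p : {dffun forall j, 'S_(d j)}) (x : node d) : node d :=
  mknode (p (tag x) (tagged x)).

Lemma block_perm_fun_inj p : injective (block_perm_fun p).
Proof.
move=> [i k] [j l] eq_p; have /= eq_ij := congr1 tag eq_p.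
case: j / eq_ij l eq_p => l; rewrite /block_perm_fun /= => /mknode_inj /perm_inj ->.
by [].
Qed.

Definition block_perm p : {perm node d} := perm (@block_perm_fun_inj p).

Lemma block_perm_inj : injective block_perm.
Proof.
move=> p q eq_pq; apply/ffunP => j; apply/permP => k.
have := congr1 (fun s : {perm node d} => s (mknode k)) eq_pq.
by rewrite !permE => /mknode_inj.
Qed.

Definition tag_perms : {set {perm node d}} :=
  [set s : {perm node d} | [forall x, tag (s x) == tag x]].

Lemma block_perm_imset : block_perm @: finset.setT = tag_perms.
Proof.
apply/setP => s; apply/imsetP/idP => [[p _ ->]|].
  by rewrite inE; apply/forallP => x; rewrite permE.
rewrite inE => /forallP st.
have sE j (k : 'I_(d j)) : mknode (tagged_as (mknode k) (s (mknode k))) = s (mknode k).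
  have := eqP (st (mknode k)); case: (s (mknode k)) => i l /= eq_ij.
  by case: j / eq_ij k => k; rewrite tagged_asE.
pose q j (k : 'I_(d j)) : 'I_(d j) := tagged_as (mknode k) (s (mknode k)).
have q_inj j : injective (q j).
  move=> k l eq_kl; apply/mknode_inj/(@perm_inj _ s).
  by rewrite -(sE j k) -(sE j l) -/(q j k) eq_kl.
exists [ffun j => perm (@q_inj j)] => //; apply/permP => -[j k].
by rewrite permE /block_perm_fun ffunE permE /= /q sE.
Qed.

Lemma card_tag_perms : #|tag_perms| = (\prod_j (d j)`!)%N.
Proof.
rewrite -block_perm_imset card_imset; last exact: block_perm_inj.
rewrite cardsT card_dep_ffun foldrE big_map big_enum /=.
by apply: eq_bigr => j _; rewrite card_Sn.
Qed.

(** The permutations with target [c] form a coset of the group of those preserving every T_j. *)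
Lemma card_target (c : {ffun node d -> 'I_N}) : (forall j, #|[set x | c x == j]| = d j) ->
  #|[set s | target s == c]| = (\prod_j (d j)`!)%N.
Proof.
move=> cd.
pose fibre j := [set x | c x == j].
(* A representative of the coset: [x] goes to the node of player [c x] whose position is that of [x]
   in its fibre. *)
have idx x : (index x (enum (fibre (c x))) < d (c x))%N.
  by rewrite -cd cardE index_mem mem_enum inE.
pose f x : node d := mknode (Ordinal (idx x)).
have f_inj : injective f.
  move=> x y eq_f; have /= eq_c := congr1 tag eq_f.
  have /= := congr1 (fun z : node d => nat_of_ord (tagged z)) eq_f.
  have mem_fibre z : c z = c y -> z \in enum (fibre (c y)).
    by move=> cz; rewrite mem_enum inE cz.
  rewrite eq_c => eq_i; rewrite -(nth_index x (mem_fibre x eq_c)) eq_i.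
  by rewrite nth_index // mem_fibre.
pose s0 := perm f_inj.
rewrite -card_tag_perms -(card_imset (mem tag_perms) (mulgI s0)); congr #|pred_of_set _|.
apply/setP => s; rewrite inE; apply/eqP/imsetP => [sc|[p]].
  exists (s0^-1 * s)%g; last by rewrite mulKVg.
  rewrite inE; apply/forallP => x; rewrite permM.
  have := congr1 (fun g : {ffun node d -> 'I_N} => g ((s0^-1)%g x)) sc.
  by rewrite ffunE => ->; rewrite -{2}(permKV s0 x) [s0 _]permE.
rewrite inE => /forallP pt ->; apply/ffunP => x.
by rewrite ffunE permM (eqP (pt _)) permE.
Qed.

(** A permutation along edges uses each column once, so it contributes the product of the 1/d_j!;
    and each assignment is the target of exactly the product of the d_j! permutations. *)
Lemma permanent_graph_matrix (R : realType) (gamma : rel 'I_N) :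
  permanent (graph_matrix R d gamma) =
  #|assignments (fun x : node d => [set j | gamma (tag x) j])|%:R.
Proof.
pose w j : R := (((d j)`!)%:R `^ ((d j)%:R^-1))^-1.
pose A (x y : node d) : R := if node_graph gamma x y then w (tag y) else 0.
set C := assignments _.
have -> : permanent (graph_matrix R d gamma) = \sum_(s : {perm node d}) \prod_x A x (s x).
  rewrite -sum_perm_enum; apply: eq_bigr => s _; apply: eq_bigr => a _.
  by rewrite mxE.
have wE : \prod_(x : node d) w (tag x) = \prod_j ((d j)`!)%:R^-1.
  have -> : \prod_j ((d j)`!)%:R^-1 = \prod_j \prod_(l < d j) w j.
    apply: eq_bigr => j _; rewrite prodr_const card_ord /w exprVn; congr _^-1.
    have [->|dj] := posnP (d j); first by rewrite expr0.
    rewrite -powR_mulrn ?powR_ge0 // -powRrM mulVf ?powRr1 ?ler0n //.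
    by rewrite pnatr_eq0 -lt0n.
  by rewrite sig_big_dep; apply: eq_bigl => x; rewrite andbT.
have prodE (s : {perm node d}) : \prod_x A x (s x) =
    (target s \in C)%:R * \prod_j ((d j)`!)%:R^-1.
  rewrite -wE; have -> : (target s \in C) = [forall x, node_graph gamma x (s x)].
    rewrite inE [X in _ && X](_ : _ = true) ?andbT; last first.
      by apply/forallP => j; rewrite target_fibre.
    by apply: eq_forallb => x; rewrite inE ffunE.
  have [/forallP sg|] := boolP [forall x, node_graph gamma x (s x)].
    rewrite mul1r [RHS](reindex_inj (@perm_inj _ s)).
    by apply: eq_bigr => x _; rewrite /A sg.
  rewrite negb_forall => /existsP[x sx]; rewrite mul0r (bigD1 x) //= /A (negPf sx).
  by rewrite mul0r.
under eq_bigr => s _ do rewrite prodE.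
rewrite -mulr_suml -natr_sum.
have -> : (\sum_s (target s \in C) = #|C| * \prod_j (d j)`!)%N.
  rewrite -big_mkcond /= (partition_big target (mem C)) //=.
  rewrite -sum_nat_const; apply: eq_bigr => c cC.
  rewrite -(card_target (c := c)); last first.
    by move=> j; move: cC; rewrite inE => /andP[_ /forallP/(_ j)/eqP].
  rewrite -sum1dep_card; apply: eq_bigl => s.
  by case: eqP => [->|]; rewrite ?andbF // cC.
rewrite natrM natr_prod -mulrA -big_split big1 ?mulr1 //= => j _.
by rewrite mulfV // pnatr_eq0 -lt0n fact_gt0.
Qed.

End Permanent.

(** * The count for generic games *)

Lemma generic_count_assignments (R : realType) (N : nat) (d : 'I_N -> nat)
    (gamma : rel 'I_N) : irreflexive gamma ->
  for_generic_games gamma (fun u : game R d =>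
    (torus_quasiequilibria u #= `I_#|assignments (neighbours (d := d) gamma)|)%card).
Proof.
move=> gamma_irr; set C := assignments _; set D := #|C|.
pose point (c : 'I_D) : node d -> R := special_point R (enum_val c).
have C_val (c : 'I_D) : enum_val c \in C := enum_valP c.
have point_inj (c c' : 'I_D) : point c =1 point c' -> c = c'.
  by move=> /(special_point_inj (C_val c) (C_val c'))/enum_val_inj.
have [lambda lambda_inj] := separating_weights point_inj.
pose L : {mpoly R[#|{: node d}|]} := \sum_y lambda y *: sigma_var R y.
pose z (c : 'I_D) (i : 'I_#|{: node d}|) : R := point c (enum_val i).
have L_inj : injective (fun c => L.@[z c]).
  move=> c c' eq_L; apply: lambda_inj; move: eq_L; rewrite /L !(raddf_sum (meval _)) /=.
  have LE a : \sum_y (lambda y *: sigma_var R y).@[z a] = \sum_y lambda y * point a y.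
    by apply: eq_bigr => y _; rewrite mevalZ mevalXU /z enum_rankK.
  by rewrite !LE.
have z_sol c x : (product_poly (@node_param R N d) (neighbours gamma) x).@[z c] = 0.
  exact: special_point_solution.
(* Larger than the number of nodes, as the spanning result requires, and at least D, so that L^D is
   covered. *)
pose B := (#|{: node d}| + D).+1.
pose s := block_monomials d B.
have L_bounded : block_bounded (fun=> 1%N) L.
  by apply: block_bounded_sum => y _; apply/block_boundedZ/block_bounded_var.
have n_lt_B j : (\sum_(y : node d) (j \in neighbours gamma y) < B)%N.
  rewrite ltnS (leq_trans _ (leq_addr _ _)) // -sum1_card leq_sum // => y _.
  exact: leq_b1.
have D_le_B : (D <= B)%N by rewrite leqW ?leq_addl.
have Lpow k : (k < D)%N -> block_bounded (fun=> B) (L ^+ k).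
  move=> kD; apply: block_boundedW (block_bounded_exp L_bounded) => j.
  by rewrite muln1 (leq_trans (ltnW kD)).
have /fin_all_exists[bg bgP] (i : 'I_(size s)) :
    exists bg : 'rV[R]_D * {ffun node d -> {mpoly R[#|{: node d}|]}},
      (forall x, block_bounded (fun j => B - gamma (tag x) j)%N (bg.2 x)) /\
      'X_[nth 0%MM s i] = \sum_x bg.2 x * quasi_poly (special_game R gamma) x +
        \sum_(k < D) bg.1 0 k *: L ^+ k.
  have Xi : block_bounded (fun=> B) ('X_[nth 0%MM s i] : {mpoly R[#|{: node d}|]}).
    apply: block_boundedX; apply/forallP; rewrite -mem_block_monomials.
    exact: mem_nth.
  have [b [a [ab aE]]] := spanned_powers (@node_param_inj R N d)
    (@node_param_neq0 R N d) n_lt_B erefl Lpow L_inj z_sol Xi.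
  exists (\row_k b k, [ffun x => a x]); split=> [x|] /=.
    by rewrite ffunE; apply: block_boundedW (ab x) => j; rewrite inE.
  have -> : \sum_x [ffun x => a x] x * quasi_poly (special_game R gamma) x =
      \sum_x a x * product_poly (@node_param R N d) (neighbours gamma) x.
    by apply: eq_bigr => x _; rewrite ffunE quasi_special_game.
  by rewrite -aE; under [X in _ = _ + X]eq_bigr => k _ do rewrite mxE; rewrite subrK.
apply: (@generic_count R N d gamma B D (special_game R gamma) (fun i x => (bg i).2 x)
  (\matrix_(i, k) (bg i).1 0 k) lambda point) => //.
- exact: obeys_special_game.
- move=> i; have [_ ->] := bgP i; congr (_ + _).
  by apply: eq_bigr => k _; rewrite mxE.
- by move=> i x; have [] := bgP i.
- by move=> c y; apply: special_point_neq0 (C_val c) y.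
- by move=> c x; rewrite quasi_special_game //; apply: z_sol.
- by move=> u _ m c; apply: lift_special_point.
Qed.

Theorem corollary5 (R : realType) (N : nat) (d : 'I_N -> nat)
    (gamma : rel 'I_N) (gamma_irr : irreflexive gamma) :
  (irreflexive (@node_graph N d gamma) /\
   forall (x : node d) (j : 'I_N),
     (exists l : 'I_(d j), node_graph gamma x (mknode l)) ->
     forall l : 'I_(d j), node_graph gamma x (mknode l)) /\
  (forall u : game R d, obeys gamma u ->
     [/\ forall x m, m \in msupp (quasi_poly u x) ->
           forall y : node d, (var_exponent m y <= 1)%N,
         forall x m, m \in msupp (quasi_poly u x) ->
           forall y z : node d, tag y = tag z -> y != z ->
             ~ ((0 < var_exponent m y)%N /\ (0 < var_exponent m z)%N)
       & forall x y : node d, ~~ node_graph gamma x y ->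
           forall m, m \in msupp (quasi_poly u x) -> var_exponent m y = 0%N]) /\
  for_generic_games gamma (fun u : game R d =>
    exists n : nat,
      (torus_quasiequilibria u #= `I_n)%card /\
      n%:R = permanent (graph_matrix R d gamma)).
Proof.
split; first by split=> [x|x j [l]]; [apply: gamma_irr|].
split=> [u obs|].
  have le1 x m : m \in msupp (quasi_poly u x) ->
      forall j, (block_degree m j <= (gamma (tag x) j && (j != tag x) : nat))%N.
    by move=> mx j; apply: (quasi_poly_bounded obs mx).
  split.
  - move=> x m /le1 mx y; apply: leq_trans (var_exponent_le m y) _.
    by apply: leq_trans (mx (tag y)) (leq_b1 _).
  - move=> x m /le1 mx y z yz neq [y0 z0].
    have := leq_trans (var_exponent2_le m yz neq) (leq_trans (mx (tag y)) (leq_b1 _)).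
    by rewrite leqNgt -addn1 leq_add.
  - move=> x y; rewrite /node_graph => /negPf nxy m /le1 mx; apply/eqP; rewrite -leqn0.
    by apply: leq_trans (var_exponent_le m y) _; have := mx (tag y); rewrite nxy.
have [Z [algZ properZ countZ]] := generic_count_assignments R d gamma_irr.
exists Z; split=> // u obs notZ.
exists #|assignments (neighbours (d := d) gamma)|; split; first exact: countZ.
by rewrite permanent_graph_matrix.
Qed.
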